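(* Let $P_\lambda(n)$ be defined by $\sum_{n=0}^{\infty}P_\lambda(n)q^n=\lambda(q)$, where $\lambda(q)=\sum_{n=0}^{\infty}\dfrac{(-1)^nq^n(q;q^2)_n}{(-q;q)_n}$. Then for every integer $n\ge 0$, $$P_\lambda(2n)=p_{3d}(n)+2\sum_{k=1}^{\infty}(-1)^kp_{3d}(n-3k^2)=p_{3d}(n)-2p_{3d}(n-3)+2p_{3d}(n-12)-\cdots.$$
   Context: Notation: $(b;q)_n=\prod_{k=0}^{n-1}(1-bq^k)$ and $\ell_k=\prod_{m\ge1}(1-q^{km})$. $p_{3d}(n)$ is the number of partitions of $n$ into distinct parts with $3$ copies (colours), with $\sum_{n\ge0}p_{3d}(n)q^n=(\ell_2/\ell_1)^3$. The function $\lambda(q)$ is a sixth order mock theta function. Convention: $p_{3d}(m)=0$ for $m<0$. *)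

(* Defs.v *)
From HB Require Import structures.
From mathcomp Require Import all_boot all_order all_algebra.
From mathcomp Require Import boolp classical_sets functions cardinality fsbigop.

Set Implicit Arguments.
Unset Strict Implicit.
Unset Printing Implicit Defensive.

Import Order.TTheory GRing.Theory Num.Theory.
Local Open Scope ring_scope.

(* R[[q]]: [Fps a] stands for the formal series sum_n (a n) q^n. *)
Record fps (R : Type) := Fps { coef : nat -> R }.

HB.instance Definition _ (R : Type) := gen_eqMixin (fps R).
HB.instance Definition _ (R : Type) := gen_choiceMixin (fps R).

Lemma fpsP (R : Type) (f g : fps R) : (forall n, coef f n = coef g n) <-> f = g.
Proof.
split=> [|-> //]; case: f => a; case: g => b /= ab.
by congr Fps; apply/funext.
Qed.

Section FpsZmod.
Variable R : nzRingType.
Implicit Types f g h : fps R.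

Definition fps_zero : fps R := Fps (fun=> 0).
Definition fps_opp f : fps R := Fps (fun n => - coef f n).
Definition fps_add f g : fps R := Fps (fun n => coef f n + coef g n).

Fact fps_addA : associative fps_add.
Proof. by move=> f g h; apply/fpsP => n /=; rewrite addrA. Qed.
Fact fps_addC : commutative fps_add.
Proof. by move=> f g; apply/fpsP => n /=; rewrite addrC. Qed.
Fact fps_add0 : left_id fps_zero fps_add.
Proof. by move=> f; apply/fpsP => n /=; rewrite add0r. Qed.
Fact fps_addN : left_inverse fps_zero fps_opp fps_add.
Proof. by move=> f; apply/fpsP => n /=; rewrite addNr. Qed.

HB.instance Definition _ :=
  GRing.isZmodule.Build (fps R) fps_addA fps_addC fps_add0 fps_addN.

Lemma coef_fpsD f g n : coef (f + g) n = coef f n + coef g n. Proof. by []. Qed.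
Lemma coef_fpsN f n : coef (- f) n = - coef f n. Proof. by []. Qed.
Lemma coef_fps0 n : coef (0 : fps R) n = 0. Proof. by []. Qed.

End FpsZmod.

Section FpsRing.
Variable R : comNzRingType.
Implicit Types f g h : fps R.

Definition fps_one : fps R := Fps (fun n => (n == 0%N)%:R).
Definition fps_mul f g : fps R :=
  Fps (fun n => \sum_(i < n.+1) coef f i * coef g (n - i)).

(* Truncation at order N, used to transport the ring axioms from {poly R}. *)
Definition fps_trunc N f : {poly R} := \poly_(i < N.+1) coef f i.

Lemma coef_trunc N f i : (i <= N)%N -> (fps_trunc N f)`_i = coef f i.
Proof. by move=> iN; rewrite coef_poly ltnS iN. Qed.

Lemma coef_mul_trunc N f g n : (n <= N)%N ->
  coef (fps_mul f g) n = (fps_trunc N f * fps_trunc N g)`_n.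
Proof.
move=> nN; rewrite coefM /=; apply: eq_bigr => i _.
have iN : (i <= n)%N by rewrite -ltnS.
by rewrite !coef_trunc ?(leq_trans iN) // (leq_trans _ nN) // leq_subr.
Qed.

Lemma coef_mul_truncl (p : {poly R}) N f g n : (n <= N)%N ->
  (forall i, (i <= N)%N -> coef f i = p`_i) ->
  coef (fps_mul f g) n = (p * fps_trunc N g)`_n.
Proof.
move=> nN fp; rewrite coefM /=; apply: eq_bigr => i _.
have iN : (i <= n)%N by rewrite -ltnS.
rewrite coef_trunc ?(leq_trans _ nN) ?leq_subr //.
by rewrite fp // (leq_trans iN).
Qed.

Fact fps_mulC : commutative fps_mul.
Proof.
by move=> f g; apply/fpsP => n; rewrite !(@coef_mul_trunc n) // mulrC.
Qed.

Fact fps_mulA : associative fps_mul.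
Proof.
move=> f g h; apply/fpsP => n; rewrite fps_mulC.
rewrite (@coef_mul_truncl (fps_trunc n g * fps_trunc n h) n) //; last first.
  by move=> i; apply: coef_mul_trunc.
rewrite (@coef_mul_truncl (fps_trunc n f * fps_trunc n g) n) //; last first.
  by move=> i; apply: coef_mul_trunc.
by rewrite mulrC mulrA.
Qed.

Fact fps_mul1 : left_id fps_one fps_mul.
Proof.
move=> f; apply/fpsP => n /=.
by rewrite big_ord_recl /= mul1r subn0 big1 ?addr0 // => i _; rewrite mul0r.
Qed.

Fact fps_mulD : left_distributive fps_mul (@fps_add R).
Proof.
move=> f g h; apply/fpsP => n /=; rewrite -big_split /=.
by apply: eq_bigr => i _; rewrite mulrDl.
Qed.

Fact fps_one_neq0 : fps_one != 0.
Proof.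
apply/eqP => /fpsP /(_ 0%N) /= /eqP.
by rewrite oner_eq0.
Qed.

HB.instance Definition _ :=
  GRing.Zmodule_isComNzRing.Build (fps R)
    fps_mulA fps_mulC fps_mul1 fps_mulD fps_one_neq0.

Definition fpsX : fps R := Fps (fun n => (n == 1%N)%:R).

Lemma coef_fps1 n : coef (1 : fps R) n = (n == 0%N)%:R. Proof. by []. Qed.

Lemma coef_fpsM f g n :
  coef (f * g) n = \sum_(i < n.+1) coef f i * coef g (n - i).
Proof. by []. Qed.

Lemma coef_fpsXM f n :
  coef (fpsX * f) n = if n is m.+1 then coef f m else 0.
Proof.
rewrite coef_fpsM; case: n => [|n].
  by rewrite big_ord_recl big_ord0 mul0r addr0.
rewrite !big_ord_recl /= mul0r add0r mul1r subn1 big1 ?addr0 // => i _.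
by rewrite mul0r.
Qed.

Lemma coef_fpsXnM k f n :
  coef (fpsX ^+ k * f) n = if (n < k)%N then 0 else coef f (n - k).
Proof.
elim: k n => [|k IH] n; first by rewrite expr0 mul1r subn0.
by rewrite exprS -mulrA coef_fpsXM; case: n => [|n] //; rewrite IH ltnS subSS.
Qed.

End FpsRing.

Section FpsUnitRing.
Variable R : comUnitRingType.
Implicit Types f g : fps R.

Definition fps_unit : pred (fps R) := fun f => coef f 0 \is a GRing.unit.

(* The first n coefficients of 1/f. *)
Fixpoint fps_inv_seq f n : seq R :=
  if n is m.+1 then
    let s := fps_inv_seq f m in
    rcons s ((coef f 0)^-1 *
             ((m == 0%N)%:R - \sum_(k < m) coef f (m - k) * s`_k))
  else [::].

Definition fps_inv f : fps R :=
  if fps_unit f then Fps (fun n => (fps_inv_seq f n.+1)`_n) else f.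

Lemma size_fps_inv_seq f n : size (fps_inv_seq f n) = n.
Proof. by elim: n => //= n IH; rewrite size_rcons IH. Qed.

Lemma nth_fps_inv_seq f n k : (k < n)%N ->
  (fps_inv_seq f n)`_k = (fps_inv_seq f k.+1)`_k.
Proof.
elim: n => // n IH; rewrite ltnS leq_eqVlt => /predU1P[-> //|kn].
by rewrite -IH //= nth_rcons size_fps_inv_seq kn.
Qed.

Lemma coef_fps_inv f n : fps_unit f ->
  coef (fps_inv f) n =
  (coef f 0)^-1 *
    ((n == 0%N)%:R - \sum_(k < n) coef f (n - k) * coef (fps_inv f) k).
Proof.
move=> fU; rewrite /fps_inv fU [LHS]/= nth_rcons size_fps_inv_seq ltnn eqxx.
by congr (_ * (_ - _)); apply: eq_bigr => k _; rewrite nth_fps_inv_seq.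
Qed.

Fact fps_mulVr : {in fps_unit, left_inverse 1 fps_inv *%R}.
Proof.
move=> f fU; apply/fpsP => n; rewrite coef_fpsM big_ord_recr /= subnn.
rewrite [X in _ + X * _]coef_fps_inv // mulrC mulrA mulrV // mul1r.
rewrite [X in X + _](_ : _ =
  \sum_(k < n) coef f (n - k) * coef (fps_inv f) k) ?subrKC //.
by apply: eq_bigr => k _; rewrite mulrC.
Qed.

Fact fps_unitP f g : g * f = 1 -> fps_unit f.
Proof.
move/fpsP => /(_ 0%N); rewrite coef_fpsM big_ord_recl big_ord0 addr0 coef_fps1 /=.
by move=> gf; apply/unitrPr; exists (coef g 0); rewrite mulrC.
Qed.

Fact fps_inv_out : {in [predC fps_unit], fps_inv =1 id}.
Proof. by move=> f /negbTE fU; rewrite /fps_inv [fps_unit f]fU. Qed.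

HB.instance Definition _ :=
  GRing.ComNzRing_hasMulInverse.Build (fps R)
    fps_mulVr fps_unitP fps_inv_out.

Lemma fps_unitE f : (f \is a GRing.unit) = (coef f 0 \is a GRing.unit).
Proof. by []. Qed.

End FpsUnitRing.

(* sum_n F n, coefficientwise; meaningful for [fps_summable] families, since a
   \sum_(i \in A) with infinite support is 0 by convention. *)
Definition fps_summable (R : nzRingType) (F : nat -> fps R) :=
  forall m, finite_set [set n | coef (F n) m != 0].

Definition fps_sum (R : nzRingType) (F : nat -> fps R) : fps R :=
  Fps (fun m => \sum_(n \in [set: nat]) coef (F n) m).

Lemma fps_summableXn (R : comNzRingType) (F : nat -> fps R) :
  fps_summable (fun n => fpsX R ^+ n * F n).
Proof.
move=> m; apply: (@sub_finite_set _ _ `I_m.+1); last exact: finite_II.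
move=> n Fn; rewrite /mkset ltnS leqNgt; apply: contraNN Fn => mn.
by rewrite coef_fpsXnM mn.
Qed.

Definition qpoch (A : comNzRingType) (b q : A) (n : nat) : A :=
  \prod_(k < n) (1 - b * q ^+ k).

Local Notation q := (fpsX int).

Definition lambda_term (n : nat) : fps int :=
  (-1) ^+ n * q ^+ n * qpoch q (q ^+ 2) n / qpoch (- q) q n.

Definition mock_lambda : fps int := fps_sum lambda_term.

Lemma lambda_summable : fps_summable lambda_term.
Proof.
rewrite (_ : lambda_term = fun n => q ^+ n *
  ((-1) ^+ n * qpoch q (q ^+ 2) n / qpoch (- q) q n)).
  exact: fps_summableXn.
by apply/funext => n; rewrite /lambda_term [_ * q ^+ n]mulrC -!mulrA.
Qed.

(* The division in [lambda_term] is a genuine one. *)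
Lemma lambda_den_unit n : qpoch (- q) q n \is a GRing.unit.
Proof.
apply: (big_ind (fun f : fps int => f \is a GRing.unit)).
- exact: unitr1.
- by move=> f g fU gU; rewrite unitrM fU.
move=> k _; rewrite fps_unitE mulNr opprK coef_fpsD coef_fps1 coef_fpsXM addr0.
exact: unitr1.
Qed.

Definition P_lambda (n : nat) : int := coef mock_lambda n.

(* Partitions of n into distinct coloured parts, with 3 colours: the pair (i, c)
   stands for the part i.+1 in colour c, and all parts are at most n. *)
Definition p3d_nat (n : nat) : nat :=
  #|[set A : {set 'I_n * 'I_3} | (\sum_(x in A) x.1.+1 == n)%N]|.

Definition p3d (m : int) : int :=
  if m is Posz n then (p3d_nat n)%:Z else 0.

(* Main.v *)
From HB Require Import structures.
Require Import Defs.
From mathcomp Require Import all_boot all_order all_algebra.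
From mathcomp Require Import classical_sets fsbigop.
From mathcomp Require Import boolp.
From mathcomp Require Import zify ring.

(** Write ell_k = (q^k; q^k)_oo, phi(q) = sum_n q^(n^2) over the integers and
psi(q) = sum_(n >= 0) q^(n(n+1)/2). The theorem is the coefficientwise form of
[evens_lambda]: the even part of lambda, after replacing q^2 by q, equals
(-q; q)_oo^3 phi(-q^3). Indeed (-q; q)_oo^3 generates the partitions into
distinct parts of three colours ([p3d_gf]), and phi(-q^3) is the alternating
series 1 + 2 sum_k (-1)^k q^(3 k^2).

Two steps turn lambda into an indefinite theta series. The sequence
1 / (-q; q)_n is a Bailey transform, beta_n = sum_(r <= n) alpha_r / ((q)_(n-r)
(q)_(n+r+1)) with alpha_r a finite theta sum ([lambda_bailey]). Inserting this
in the definition of lambda and summing over n first leaves, for each r, a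
series that the q-Gauss summation evaluates ([gauss_sum]). The outcome,
[lambda_psi], is

  lambda(q) ell_2 ell_4 = psi(-q) D(q),
  D(q) = sum_(r >= 0) (-1)^r q^(3r(r+1)/2) sum_(|j| <= r) (-1)^j q^(-j^2).

As ell_2 ell_4 is even, it remains to find the even part of psi(-q) D(q). The
rows of D with even and odd r together form one sum over Z^2 with weight
chi (m, j), which is 1, -1 or 0, and exponent 6m^2 + 3m - j^2. Multiplied by
psi(-q) = sum_t (-1)^t q^(2t^2+t) this is a sum over Z^3, which is cut along the
planes m - t = 4k + c with c in {-1, 0, 1, 2}. In each plane the quadratic form
becomes that of a plane with k = 0, up to a constant, after shifting m by k. The
shift replaces chi (m, j) by chi (m + k, j), and this does not change the sum:
chi (m + 1, j) - chi (m, j) is carried by a few lines on which an involution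
cancels all terms ([slice_step]). The planes with c = 1 contribute 0 by
antisymmetry, those with c = 2 cancel in pairs, and the other two classes give
([evens_psi_hecke])

  phi(-q^12) S(q^2) + 2 q psi(-q^6) T(q^2),

where S and T are sums of Hecke type, over squares i^2 and over pronic
numbers i(i+1). Both are products: the telescoping lemma [bailey_limit], which
also gives Gauss's products for phi and psi and the transform for
1 / (-q; q)_n, yields S(q^2) = psi(q^2) phi(-q^4) and
T(q^2) = psi(q^2) psi(-q^2). The common factor psi(q^2) comes out, and splitting
the hexagonal lattice form x^2 + 3y^2 by parity gives ([phi_hex])

  phi(-q^4) phi(-q^12) + 2 q psi(-q^2) psi(-q^6) = phi(q) phi(-q^3).

Finally phi(q) psi(q^2) = psi(q)^2 ([phi_psi]) and psi(q) = ell_2^2 / ell_1 give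
the even part of lambda as psi(q)^2 phi(-q^3) / (ell_1 ell_2), that is,
(ell_2 / ell_1)^3 phi(-q^3).

Power series are compared modulo q^n, and every limit is taken at the rate
u_n = f mod q^n, so that limits commute with sums and products. *)

Set Implicit Arguments.
Unset Strict Implicit.
Unset Printing Implicit Defensive.

Import Order.TTheory GRing.Theory Num.Theory.
Local Open Scope ring_scope.

Local Notation q := (fpsX int).
Implicit Types (f g h : fps int) (u v : nat -> fps int) (F G : int -> int).

(** * Sums over the integers *)

(** A sum with infinite support is 0 by convention, hence the boundedness
    hypotheses of the rules below that split or exchange sums. *)
Definition zsum F : int := \sum_(i \in [set: int]) F i.

(** The values at n and -n-1 are grouped, following the two constructors of the
    integers; n and -n-1 are also the two indices of equal size in the symmetric
    form of the Hecke-type sums. *)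
Definition boxsum (A : nmodType) (F : int -> A) (B : nat) : A :=
  \sum_(j < B.+1) F (Posz j) + \sum_(j < B) F (Negz j).

Lemma boxsumS (A : nmodType) (F : int -> A) r :
  boxsum F r.+1 = boxsum F r + (F (Posz r.+1) + F (Negz r)).
Proof. by rewrite /boxsum big_ord_recr [X in _ + X = _]big_ord_recr /= addrACA. Qed.

Lemma eq_boxsum (A : nmodType) (F G : int -> A) B : F =1 G -> boxsum F B = boxsum G B.
Proof. by move=> FG; congr (_ + _); apply: eq_bigr. Qed.

Lemma boxsum_mulr (F : int -> int) B (a : int) :
  boxsum F B * a = boxsum (fun t => F t * a) B.
Proof. by rewrite /boxsum mulrDl !mulr_suml. Qed.

Lemma boxsum_exchange (n : nat) (H : nat -> int -> int) B :
  \sum_(i < n) boxsum (H i) B = boxsum (fun t => \sum_(i < n) H i t) B.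
Proof. by rewrite /boxsum big_split /=; congr (_ + _); rewrite exchange_big. Qed.

Definition supported (B : nat) F := forall i, F i != 0 -> (`|i| <= B)%N.

Lemma zsum_box B F : supported B F -> zsum F = boxsum F B.
Proof.
move=> sF; pose s := map Posz (iota 0 B.+1) ++ map Negz (iota 0 B).
have us : uniq s.
  rewrite cat_uniq !map_inj_uniq ?iota_uniq ?andbT /=; try by move=> ? ? [].
  by apply/hasPn => x /mapP[i _ ->]; apply/mapP => -[].
have -> : zsum F = \sum_(i <- s) F i.
  rewrite (@bigfs _ _ _ _ s xpredT) //; first by apply: eq_fsbigl; apply/seteqP.
  move=> i _; apply: contraNeq => /sF iB.
  rewrite mem_cat; apply/orP; case: i iB => n nB; [left|right];
    by apply: map_f; rewrite mem_iota; lia.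
rewrite big_cat !big_map /boxsum -(big_mkord xpredT (fun j => F (Posz j))).
by rewrite -(big_mkord xpredT (fun j => F (Negz j))) /index_iota !subn0.
Qed.

Lemma eq_zsum F G : F =1 G -> zsum F = zsum G.
Proof. by move=> FG; apply: eq_fsbigr => i _. Qed.
Lemma zsum0 F : (forall i, F i = 0) -> zsum F = 0.
Proof. by move=> F0; apply: fsbig1 => i _. Qed.
Lemma zsumM F (a : int) : zsum (fun i => a * F i) = a * zsum F.
Proof. by rewrite /zsum mulr_fsumr. Qed.

Lemma boxsumD (F G : int -> int) B :
  boxsum (fun i => F i + G i) B = boxsum F B + boxsum G B.
Proof. by rewrite /boxsum !big_split /= addrACA. Qed.

Lemma supportedW B C F : supported B F -> (B <= C)%N -> supported C F.
Proof. by move=> sF BC i /sF /leq_trans; apply. Qed.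

Definition bounded F := exists B, supported B F.

Lemma zsumD F G : bounded F -> bounded G ->
  zsum (fun i => F i + G i) = zsum F + zsum G.
Proof.
move=> [B sF] [C sG].
have sF' : supported (B + C) F by apply: supportedW sF _; lia.
have sG' : supported (B + C) G by apply: supportedW sG _; lia.
rewrite !(@zsum_box (B + C)) // ?boxsumD // => i; case: (eqVneq (F i) 0) => [->|/sF' //].
by rewrite add0r => /sG'.
Qed.

Lemma zsum_reindex (h g : int -> int) F : cancel h g -> cancel g h ->
  zsum F = zsum (fun i => F (h i)).
Proof. by move=> hK gK; apply: reindex_fsbigT; exists g. Qed.

Lemma zshift (a : int) (F : int -> int) : zsum F = zsum (fun x => F (a + x)).
Proof.
have hK : cancel (fun d : int => a + d) (fun d => d - a) by move=> d; lia.
have gK : cancel (fun d : int => d - a) (fun d => a + d) by move=> d; lia.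
exact: (zsum_reindex F hK gK).
Qed.

Lemma zflip (a : int) (F : int -> int) : zsum F = zsum (fun x => F (a - x)).
Proof.
have hK : cancel (fun d : int => a - d) (fun d => a - d) by move=> d; lia.
exact: (zsum_reindex F hK hK).
Qed.

(** Used to restrict a sum to an arithmetic progression that carries its support. *)
Lemma zsum_inj (h : int -> int) F : injective h ->
  (forall i, F i != 0 -> exists j, i = h j) -> zsum F = zsum (fun i => F (h i)).
Proof.
move=> hI Fh; rewrite /zsum.
transitivity (\sum_(i \in h @` [set: int]) F i)%classic; last first.
  by rewrite fsbig_image // => x y _ _; apply: hI.
apply/esym/fsbig_widen => // i [_ /= ni]; apply/eqP; apply: contra_notT ni => /Fh[j ->].
by exists j.
Qed.

(** The sum equals its own opposite. All cancellations between lines and between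
    planes of the triple sum have this form. *)
Lemma zsum_anti (h : int -> int) F : involutive h ->
  (forall i, F (h i) = - F i) -> zsum F = 0.
Proof.
move=> hK Fh; have : zsum F = - zsum F.
  rewrite -mulN1r -zsumM [LHS](zsum_reindex F hK hK).
  by apply: eq_zsum => i; rewrite Fh mulN1r.
lia.
Qed.

Lemma zsum_exchange B (H : int -> int -> int) :
    (forall i j, H i j != 0 -> (`|i| <= B)%N /\ (`|j| <= B)%N) ->
  zsum (fun i => zsum (H i)) = zsum (fun j => zsum (H^~ j)).
Proof.
move=> sH.
have E1 i : zsum (H i) = boxsum (H i) B by apply: zsum_box => j /sH[].
have E2 j : zsum (H^~ j) = boxsum (H^~ j) B by apply: zsum_box => i /sH[].
have bs (K : int -> int) : boxsum K B != 0 -> exists j, K j != 0.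
  rewrite /boxsum => nz; case: (pickP (fun j : 'I_B.+1 => K (Posz j) != 0)) => [j ?|K1].
    by exists (Posz j).
  case: (pickP (fun j : 'I_B => K (Negz j) != 0)) => [j ?|K2]; first by exists (Negz j).
  move: nz; rewrite !big1 ?addr0 ?eqxx // => j _; apply/eqP.
    by move/negbFE: (K2 j).
  by move/negbFE: (K1 j).
rewrite (eq_zsum E1) (eq_zsum E2) (@zsum_box B); last by move=> i /bs[j /sH[]].
rewrite (@zsum_box B); last by move=> j /bs[i /sH[]].
rewrite /boxsum !big_split /= addrACA; congr (_ + _ + (_ + _));
  exact: exchange_big.
Qed.

(** Coordinates x and d = y - x: in quadratic forms such as x^2 + 3y^2 it is the
    parity of d that matters. *)
Lemma zsum_shear B (F : int -> int -> int) :
    (forall x y, F x y != 0 -> (`|x| <= B)%N /\ (`|y| <= B)%N) ->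
  zsum (fun x => zsum (F x)) = zsum (fun d => zsum (fun x => F x (x + d))).
Proof.
move=> FB; transitivity (zsum (fun x => zsum (fun d => F x (x + d)))).
  apply: eq_zsum => x.
  have hK : cancel (fun d : int => x + d) (fun d => d - x) by move=> d; lia.
  have gK : cancel (fun d : int => d - x) (fun d => x + d) by move=> d; lia.
  by rewrite (zsum_reindex _ hK gK).
by rewrite (@zsum_exchange (2 * B)) // => x d /FB; lia.
Qed.

Lemma zsum_nz F : zsum F != 0 -> exists i, F i != 0.
Proof.
move=> nz; apply: contrapT => nF; move/eqP: nz; apply.
by apply: zsum0 => i; apply/eqP; apply: contraPT isT => Fi _; apply: nF; exists i.
Qed.

Lemma bounded_zsum (F : int -> int -> int) (B : nat) :
  (forall d x, F d x != 0 -> (`|d| <= B)%N) -> bounded (fun d => zsum (F d)).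
Proof. by move=> FB; exists B => d /zsum_nz[x /FB]. Qed.

Lemma bounded_range (r : nat) (P : pred int) (g : int -> int) :
  (forall i, P i -> (`|i| <= r)%N) -> bounded (fun i => if P i then g i else 0).
Proof. by move=> Pr; exists r => i; case: ifP => // /Pr. Qed.

Lemma bounded_mul a F : bounded F -> bounded (fun i => a * F i).
Proof. by move=> [B sF]; exists B => i; case: (eqVneq (F i) 0) => [->|/sF //]; rewrite mulr0. Qed.

Lemma zsum_parity F : bounded F ->
  zsum F = zsum (fun i => F (2 * i)) + zsum (fun i => F (2 * i + 1)).
Proof.
move=> [B sF].
(* P i says that i is even. *)
pose P (i : int) := (i == 2 * (i %/ 2)%Z).
pose F0 i := if P i then F i else 0; pose F1 i := if P i then 0 else F i.
rewrite (_ : zsum F = zsum F0 + zsum F1); last first.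
  rewrite -zsumD; first by apply: eq_zsum => i; rewrite /F0 /F1; case: (P i); rewrite ?addr0 ?add0r.
    by exists B => i; rewrite /F0; case: (P i) => // /sF.
  by exists B => i; rewrite /F1; case: (P i) => // /sF.
rewrite (@zsum_inj (fun i => 2 * i) F0); first last.
- by move=> i; rewrite /F0; case: (P i) / eqP => // -> _; eexists.
- by move=> x y; lia.
rewrite (@zsum_inj (fun i => 2 * i + 1) F1); first last.
- by move=> i; rewrite /F1 /P; case: ifPn => // ? _; exists (i %/ 2)%Z; lia.
- by move=> x y; lia.
by congr (_ + _); apply: eq_zsum => i; rewrite /F0 /F1 /P; case: ifPn => //; lia.
Qed.

Lemma zsum_delta (a : int) F : zsum (fun i => if i == a then F i else 0) = F a.
Proof.
transitivity (\sum_(i \in [set a]) F i)%classic; last by rewrite fsbig_set1.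
rewrite /zsum -(@fsbig_widen _ _ _ _ [set a]%classic [set: int]%classic
  (fun i => if i == a then F i else 0)) //; last first.
  by move=> i [_ /= /eqP/negbTE ->].
by apply: eq_fsbigr => i /set_mem /= ->; rewrite eqxx.
Qed.

Lemma zsum_pairs B F : (forall i, F i != 0 -> (`|i| < B)%N) ->
  zsum F = \sum_(n < B) (F (Posz n) + F (Negz n)).
Proof.
move=> sF; rewrite (@zsum_box B); last by move=> i /sF; lia.
rewrite /boxsum big_ord_recr /= big_split /=.
suff -> : F (Posz B) = 0 by rewrite addr0.
by apply/eqP; apply: contraTT isT => /sF; rewrite ltnn.
Qed.

Definition sg (j : int) : int := (-1) ^+ `|j|%N.

Lemma sgPosz (n : nat) : sg n = (-1) ^+ n. Proof. by []. Qed.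
Lemma sgNegz r : sg (Negz r) = - (-1) ^+ r.
Proof. by rewrite /sg /= exprS mulN1r. Qed.
Lemma sgE (a : int) : sg a = (-1) ^+ odd `|a|%N.
Proof. by rewrite /sg signr_odd. Qed.
Lemma sgD (a b : int) : sg (a + b) = sg a * sg b.
Proof. by rewrite !sgE -signr_addb; congr (_ ^+ nat_of_bool _); lia. Qed.
Lemma sgN (a : int) : sg (- a) = sg a.
Proof. by rewrite /sg abszN. Qed.
Lemma sg_even (a : int) : sg (2 * a) = 1.
Proof. by rewrite sgE (_ : odd _ = false) //; lia. Qed.
Lemma sg_odd (a : int) : sg (2 * a + 1) = -1.
Proof. by rewrite sgE (_ : odd _ = true) //; lia. Qed.

Lemma pronic_bound (j : int) (r : nat) : (`|j| <= r)%N -> j * (j + 1) <= r%:Z * r%:Z + r%:Z.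
Proof.
move=> jr; have : 0 <= (r%:Z - j) * (r%:Z + j + 1) by apply: mulr_ge0; lia.
lia.
Qed.

Lemma square_bound (j : int) (r : nat) : (`|j| <= r)%N -> j * j <= r%:Z * r%:Z.
Proof.
move=> jr; have : 0 <= (r%:Z - j) * (r%:Z + j) by apply: mulr_ge0; lia.
lia.
Qed.

Lemma bin2_double n : (2 * 'C(n.+1, 2) = n * n.+1)%N.
Proof. by elim: n => [//|n IH]; rewrite binS bin1 mulnDr IH; lia. Qed.

Lemma sum_even_odd (c : nat -> int) B :
  \sum_(r < 2 * B) c r = \sum_(n < B) (c (2 * n)%N + c (2 * n).+1).
Proof.
elim: B => [|B IH]; first by rewrite muln0 !big_ord0.
by rewrite mulnS add2n !big_ord_recr /= IH addrA.
Qed.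

Lemma sum_stable (c : nat -> int) m n : (m < n)%N ->
  (forall i, (m < i)%N -> c i = 0) -> \sum_(i < n) c i = \sum_(i < m.+1) c i.
Proof.
move=> mn c0; rewrite -!(big_mkord xpredT c) (@big_cat_nat _ _ _ m.+1) //=.
rewrite [X in _ + X]big_nat_cond [X in _ + X]big1 ?addr0 // => i /andP[/andP[mi _] _].
exact: c0.
Qed.

(** * Congruences and limits of power series *)

(** Congruence modulo q^n. *)
Definition eqm n f g := forall m, (m < n)%N -> coef f m = coef g m.

Lemma eqm_refl n f : eqm n f f. Proof. by []. Qed.
Lemma eqm_sym n f g : eqm n f g -> eqm n g f.
Proof. by move=> fg m /fg. Qed.
Lemma eqm_trans n g f h : eqm n f g -> eqm n g h -> eqm n f h.
Proof. by move=> fg gh m mn; rewrite fg // gh. Qed.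
Lemma eqmW n k f g : eqm n f g -> (k <= n)%N -> eqm k f g.
Proof. by move=> fg kn m mk; apply: fg; apply: leq_trans kn. Qed.
Lemma eqmD n f f' g g' : eqm n f f' -> eqm n g g' -> eqm n (f + g) (f' + g').
Proof. by move=> ff gg m mn; rewrite !coef_fpsD ff // gg. Qed.

Lemma eqmM n f f' g g' : eqm n f f' -> eqm n g g' -> eqm n (f * g) (f' * g').
Proof.
move=> ff gg m mn; rewrite !coef_fpsM; apply: eq_bigr => i _.
by rewrite ff ?gg //; have := ltn_ord i; lia.
Qed.

Lemma eqm_sum n (I : Type) (r : seq I) (P : pred I) (F G : I -> fps int) :
  (forall i, P i -> eqm n (F i) (G i)) ->
  eqm n (\sum_(i <- r | P i) F i) (\sum_(i <- r | P i) G i).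
Proof.
move=> FG; elim/big_rec2: _ => [|i f g Pi fg]; first exact: eqm_refl.
by apply: eqmD => //; apply: FG.
Qed.

Lemma eqm0M (a b : nat) f g : eqm a f 0 -> eqm b g 0 -> eqm (a + b) (f * g) 0.
Proof.
move=> f0 g0 m mab; rewrite coef_fpsM big1 // => i _.
case: (ltnP i a) => ia; first by rewrite f0 // mul0r.
by rewrite g0 ?mulr0 //; have := ltn_ord i; lia.
Qed.

Lemma eqm0Ml n f g : eqm n f 0 -> eqm n (f * g) 0.
Proof. by move=> f0; rewrite -(addn0 n); apply: eqm0M. Qed.
Lemma eqm0Mr n f g : eqm n g 0 -> eqm n (f * g) 0.
Proof. by rewrite mulrC; apply: eqm0Ml. Qed.

Lemma eqm0X n f : coef f 0 = 0 -> eqm n (f ^+ n) 0.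
Proof.
move=> f0; elim: n => [|n IH]; first by [].
by rewrite exprS -add1n; apply: eqm0M => // -[].
Qed.

Lemma eqm0Xk n r f : coef f 0 = 0 -> (n <= r)%N -> eqm n (f ^+ r) 0.
Proof. by move=> f0 nr; apply: eqmW nr; apply: eqm0X. Qed.

Lemma eqm_unit n f g h : h \is a GRing.unit -> eqm n (f * h) (g * h) -> eqm n f g.
Proof.
move=> uh fg; rewrite -(mulrK uh f) -(mulrK uh g); exact: eqmM fg (eqm_refl _).
Qed.

Lemma eqm_sub0 n f g : eqm n (f - g) 0 -> eqm n f g.
Proof. by move=> fg m /fg; rewrite coef_fpsD coef_fpsN coef_fps0 => /eqP; rewrite subr_eq0 => /eqP. Qed.
Lemma eqm_subr0 n f g : eqm n f g -> eqm n (f - g) 0.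
Proof. by move=> fg m /fg; rewrite coef_fpsD coef_fpsN coef_fps0 => ->; rewrite subrr. Qed.

(** A factor divisible by q^r makes the congruence of the other factor cheaper by r. *)
Lemma eqm_mull r n f g h : (r <= n)%N -> eqm r h 0 -> eqm (n - r) f g ->
  eqm n (h * f) (h * g).
Proof.
move=> rn h0 /eqm_subr0 fg; apply: eqm_sub0; rewrite -mulrBr -(subnKC rn).
exact: eqm0M.
Qed.

Lemma eqmV n f g : f \is a GRing.unit -> g \is a GRing.unit ->
  eqm n f g -> eqm n f^-1 g^-1.
Proof.
move=> fu gu fg; apply: (eqm_unit fu); rewrite mulVr //.
apply: (eqm_unit gu); rewrite mul1r mulrAC mulVr // mul1r; exact: eqm_sym.
Qed.

Lemma eqm_eq f g : (forall n, eqm n f g) -> f = g.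
Proof. by move=> fg; apply/fpsP => n; apply: (fg n.+1). Qed.

(** Convergence at a prescribed rate: the n-th term is already correct modulo q^n.
    With a common rate, limits add and multiply termwise. *)
Definition cv u f := forall n, eqm n (u n) f.

Lemma cv_uniq u f g : cv u f -> cv u g -> f = g.
Proof. by move=> uf ug; apply: eqm_eq => n; apply: eqm_trans (ug n); apply: eqm_sym. Qed.
Lemma cv_ext u v f : cv u f -> u =1 v -> cv v f.
Proof. by move=> uf uv n; rewrite -uv. Qed.
Lemma cv_add u v f g : cv u f -> cv v g -> cv (fun n => u n + v n) (f + g).
Proof. by move=> uf vg n; apply: eqmD. Qed.
Lemma cv_mul u v f g : cv u f -> cv v g -> cv (fun n => u n * v n) (f * g).
Proof. by move=> uf vg n; apply: eqmM. Qed.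
Lemma cv_cst f : cv (fun=> f) f. Proof. by []. Qed.
Lemma cv_sub (s : nat -> nat) u f : (forall n, (n <= s n)%N) -> cv u f -> cv (u \o s) f.
Proof. by move=> ns uf n /=; apply: eqmW (uf _) (ns n). Qed.
Lemma cv_eqm u v f : cv u f -> (forall n, eqm n (u n) (v n)) -> cv v f.
Proof. by move=> uf uv n; apply: eqm_trans (uf n); apply: eqm_sym. Qed.

(** The coefficient of q^m is read off at the first index where it is final. *)
Definition qlim u : fps int := Fps (fun m => coef (u m.+1) m).

Lemma cv_qlim u : (forall n, eqm n (u n) (u n.+1)) -> cv u (qlim u).
Proof.
move=> st n m mn /=.
have st' k : eqm m.+1 (u (m.+1 + k)%N) (u m.+1).
  elim: k => [|k IH]; first by rewrite addn0.
  by rewrite addnS; apply: eqm_trans IH; apply/eqm_sym/(eqmW (st _)); lia.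
by rewrite -(subnKC mn) st'.
Qed.

HB.lock Definition ssum (u : nat -> fps int) : fps int := qlim (fun n => \sum_(r < n) u r).

Lemma cv_ssum u : (forall r, eqm r (u r) 0) -> cv (fun n => \sum_(r < n) u r) (ssum u).
Proof.
move=> u0; rewrite ssum.unlock; apply: cv_qlim => n; rewrite big_ord_recr /= -[X in eqm _ X _]addr0.
by apply: eqmD; [exact: eqm_refl | apply/eqm_sym/u0].
Qed.

Lemma coef_bigsum (I : Type) (r : seq I) (P : pred I) (F : I -> fps int) m :
  coef (\sum_(i <- r | P i) F i) m = \sum_(i <- r | P i) coef (F i) m.
Proof. exact: (big_morph (fun f => coef f m) (fun f g => coef_fpsD f g m) (coef_fps0 _ m)). Qed.

Lemma coef_ssum u N : coef (ssum u) N = \sum_(r < N.+1) coef (u r) N.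
Proof. by rewrite ssum.unlock /qlim /= coef_bigsum. Qed.

Lemma coef_fsum (F : nat -> fps int) N : (forall n, eqm n (F n) 0) ->
  coef (fps_sum F) N = \sum_(n < N.+1) coef (F n) N.
Proof.
move=> F0; rewrite (fsbig_ord _ _ (fun n => coef (F n) N)) /=.
apply/esym/fsbig_widen => // n [_ /= nN]; apply: F0; lia.
Qed.

Lemma coef_signM n f m : coef ((-1) ^+ n * f) m = (-1) ^+ n * coef f m.
Proof.
elim: n => [|n IH]; first by rewrite !mul1r.
by rewrite !exprS !mulN1r !mulNr coef_fpsN IH.
Qed.

Lemma ssumMr u f : (forall r, eqm r (u r) 0) -> ssum u * f = ssum (fun r => u r * f).
Proof.
move=> u0; have uf0 r : eqm r (u r * f) 0 by apply/eqm0Ml/u0.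
apply/esym/(cv_uniq (cv_ssum uf0))/(cv_ext (cv_mul (cv_ssum u0) (cv_cst f))) => n.
by rewrite mulr_suml.
Qed.

Lemma unit_coef1 f : coef f 0 = 1 -> f \is a GRing.unit.
Proof. by move=> f1; rewrite fps_unitE f1 unitr1. Qed.

Lemma unit_fracK (x y : fps int) : x \is a GRing.unit -> y \is a GRing.unit ->
  x / (x * y) = y^-1.
Proof. by move=> xu yu; rewrite invrM // mulrCA divrr // mulr1. Qed.

Lemma coef_fpsM0 f g : coef (f * g) 0 = coef f 0 * coef g 0.
Proof. by rewrite coef_fpsM big_ord_recl big_ord0 addr0. Qed.

(** The monomial c q^e. Integer exponents are allowed because those of the
    Hecke-type sums are quadratic expressions that are non-negative only in the
    range of summation; a negative exponent gives 0. *)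
Definition mono (c e : int) : fps int := Fps (fun n => if e == n%:Z then c else 0).

Lemma coef_mono c e n : coef (mono c e) n = if e == n%:Z then c else 0.
Proof. by []. Qed.

Lemma qXn k : q ^+ k = mono 1 k%:Z.
Proof.
apply/fpsP => n; rewrite -[q ^+ k]mulr1 coef_fpsXnM coef_fps1 coef_mono.
by case: ltnP => ?; [rewrite ifF //|case: (_ =P 0%N) => ?; [rewrite ifT|rewrite ifF]]; lia.
Qed.

Lemma coef_qXM k f n : coef (q ^+ k * f) n = if (n < k)%N then 0 else coef f (n - k).
Proof. exact: coef_fpsXnM. Qed.

Lemma mono_shift k c e : 0 <= e -> q ^+ k * mono c e = mono c (k%:Z + e).
Proof.
move=> e0; apply/fpsP => n; rewrite coef_qXM !coef_mono; case: ltnP => nk.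
  by rewrite ifF //; lia.
by congr (if _ then _ else _); lia.
Qed.

Lemma monoN c e : mono (- c) e = - mono c e.
Proof. by apply/fpsP => n; rewrite coef_fpsN !coef_mono; case: eqP => //; rewrite oppr0. Qed.
Lemma mono_sign n e : mono ((-1) ^+ n) e = (-1) ^+ n * mono 1 e.
Proof. by elim: n => [|n IH]; rewrite ?mul1r // !exprS mulN1r monoN IH mulN1r mulNr. Qed.
Lemma coef0X f n : coef f 0 = 0 -> (0 < n)%N -> coef (f ^+ n) 0 = 0.
Proof. by move=> f0 n0; have := @eqm0X n f f0; apply. Qed.
Lemma coef0q k : (0 < k)%N -> coef (q ^+ k) 0 = 0.
Proof. by move=> k0; rewrite coef0X. Qed.
Lemma coefq : coef q 0 = 0. Proof. by []. Qed.

(** * Infinite products *)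

Lemma qpochS (A : comNzRingType) (b p : A) n : qpoch b p n.+1 = qpoch b p n * (1 - b * p ^+ n).
Proof. by rewrite /qpoch big_ord_recr. Qed.
Lemma qpoch0 (A : comNzRingType) (b p : A) : qpoch b p 0 = 1 :> A.
Proof. by rewrite /qpoch big_ord0. Qed.

Lemma qpochSl (A : comNzRingType) (b p : A) n : qpoch b p n.+1 = (1 - b) * qpoch (b * p) p n.
Proof.
rewrite /qpoch big_ord_recl expr0 mulr1; congr (_ * _); apply: eq_bigr => i _.
by rewrite lift0 exprS mulrA.
Qed.

Lemma qpochD (A : comNzRingType) (b p : A) m n :
  qpoch b p (m + n) = qpoch b p m * qpoch (b * p ^+ m) p n.
Proof.
elim: n => [|n IH]; first by rewrite addn0 qpoch0 mulr1.
by rewrite addnS !qpochS IH -mulrA -[b * _ * _]mulrA -exprD.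
Qed.

Lemma qpoch_coef0 (b p : fps int) n : coef b 0 = 0 -> coef (qpoch b p n) 0 = 1.
Proof.
move=> b0; elim: n => [|n IH]; first by rewrite qpoch0.
by rewrite qpochS coef_fpsM0 IH coef_fpsD coef_fpsN coef_fpsM0 b0 mul0r oppr0 addr0 mulr1.
Qed.

Lemma qpoch_unit (b p : fps int) n : coef b 0 = 0 -> qpoch b p n \is a GRing.unit.
Proof. by move=> b0; apply/unit_coef1/qpoch_coef0. Qed.

(** The infinite product (b; p)_oo. *)
HB.lock Definition pinf (b p : fps int) : fps int := qlim (qpoch b p).

Lemma cv_pinf (b p : fps int) : coef p 0 = 0 -> cv (qpoch b p) (pinf b p).
Proof.
move=> p0; rewrite pinf.unlock; apply: cv_qlim => n; rewrite qpochS mulrBr mulr1.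
rewrite -[X in eqm _ X _]addr0; apply: eqmD; first exact: eqm_refl.
apply: eqm_sym; rewrite mulrA -mulrN mulrC.
have -> : - p ^+ n * (qpoch b p n * b) = p ^+ n * (- (qpoch b p n * b)) by rewrite mulNr mulrN.
exact/eqm0Ml/eqm0X.
Qed.

Lemma pinf_coef0 (b p : fps int) : coef p 0 = 0 -> coef b 0 = 0 -> coef (pinf b p) 0 = 1.
Proof. by move=> p0 b0; rewrite -(@cv_pinf b p p0 1%N) // qpoch_coef0. Qed.
Lemma pinf_unit (b p : fps int) : coef p 0 = 0 -> coef b 0 = 0 -> pinf b p \is a GRing.unit.
Proof. by move=> p0 b0; apply/unit_coef1/pinf_coef0. Qed.

Lemma pinf_split (b p : fps int) n : coef p 0 = 0 -> pinf b p = qpoch b p n * pinf (b * p ^+ n) p.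
Proof.
move=> p0; apply: (@cv_uniq (fun m => qpoch b p (n + m))).
  by apply: (cv_sub (s := addn n)); [move=> m; exact: leq_addl | exact: cv_pinf].
apply: cv_ext (cv_mul (cv_cst _) (cv_pinf (b * p ^+ n) p0)) _ => m.
by rewrite qpochD.
Qed.

Lemma pinf_odd_even (p : fps int) : coef p 0 = 0 ->
  pinf p p = pinf p (p ^+ 2) * pinf (p ^+ 2) (p ^+ 2).
Proof.
move=> p0; have p20 : coef (p ^+ 2) 0 = 0 by rewrite coef0X.
apply: (@cv_uniq (fun m => qpoch p p m.*2)).
  by apply: (cv_sub (s := double)); [move=> m; lia | exact: cv_pinf].
apply: cv_ext (cv_mul (cv_pinf p p20) (cv_pinf (p ^+ 2) p20)) _ => m.
elim: m => [|m IH]; first by rewrite !qpoch0 mulr1.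
by rewrite doubleS !qpochS -IH -!exprM mul2n [p ^+ m.*2.+1]exprS; ring.
Qed.

Lemma pinf_pm (b p : fps int) : coef p 0 = 0 ->
  pinf b p * pinf (- b) p = pinf (b ^+ 2) (p ^+ 2).
Proof.
move=> p0; have p20 : coef (p ^+ 2) 0 = 0 by rewrite coef0X.
apply: (@cv_uniq (qpoch (b ^+ 2) (p ^+ 2))); last exact: cv_pinf.
apply: cv_ext (cv_mul (cv_pinf b p0) (cv_pinf (- b) p0)) _ => m.
elim: m => [|m IH]; first by rewrite !qpoch0 mulr1.
by rewrite !qpochS -IH -exprM mulnC exprM; ring.
Qed.

(** Euler's function (q^k; q^k)_oo. The lemmas below reduce the products with base
    q^k or q^2k, odd exponents and minus signs to quotients of such functions. *)
HB.lock Definition ell (k : nat) : fps int := pinf (q ^+ k) (q ^+ k).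

Lemma ellE k : pinf (q ^+ k) (q ^+ k) = ell k.
Proof. by rewrite ell.unlock. Qed.
Lemma ell_coef0 k : (0 < k)%N -> coef (ell k) 0 = 1.
Proof. by move=> k0; rewrite -ellE pinf_coef0 // coef0q. Qed.
Lemma ell_unit k : (0 < k)%N -> ell k \is a GRing.unit.
Proof. by move=> k0; apply/unit_coef1/ell_coef0. Qed.

Lemma pinf_odd k : (0 < k)%N ->
  pinf (q ^+ k) (q ^+ (2 * k)) * ell (2 * k) = ell k.
Proof.
by move=> k0; rewrite -[RHS]ellE pinf_odd_even ?coef0q // -!exprM mulnC ellE.
Qed.

Lemma pinf_neg k : (0 < k)%N ->
  ell k * pinf (- q ^+ k) (q ^+ k) = ell (2 * k).
Proof.
by move=> k0; rewrite -!ellE pinf_pm ?coef0q // -!exprM mulnC.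
Qed.

(** From (q^k; q^2k)_oo (-q^k; q^2k)_oo = (q^2k; q^4k)_oo, both odd products being
    known. *)
Lemma pinf_odd_neg k : (0 < k)%N ->
  pinf (- q ^+ k) (q ^+ (2 * k)) * (ell k * ell (4 * k)) = ell (2 * k) ^+ 2.
Proof.
move=> k0; have k20 : (0 < 2 * k)%N by lia.
have := pinf_pm (q ^+ k) (coef0q k20).
rewrite -!exprM [(k * 2)%N]mulnC [(2 * k * 2)%N]mulnC => E.
have /esym E4 := pinf_odd k20; rewrite -E mulnA in E4.
rewrite -{1}(pinf_odd k0) expr2 {2}E4; ring.
Qed.

(** * A telescoping lemma of Bailey type *)

(** Here (p)_n is (p; p)_n. The object is a sequence
    B_n = sum_(r <= n) al_r / ((p)_(n-r) (p)_(n+r+1)) whose consecutive terms have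
    the ratio 1 / (1 - b1 p^n + b2 p^(2n)), so that B_n is a finite product and its
    limit, sum_r al_r / (p; p)_oo^2, an infinite one. *)
Section Bailey.

Variable p : fps int.
Hypothesis p0 : coef p 0 = 0.
Let P n := qpoch p p n.
Let c n r := (P (n - r) * P (n + r))^-1.

Lemma qpochp_unit n : P n \is a GRing.unit. Proof. exact: qpoch_unit. Qed.
Lemma qpochpS n : P n.+1 = P n * (1 - p ^+ n.+1).
Proof. by rewrite /P qpochS exprS. Qed.
Lemma one_subX_unit n : 1 - p ^+ n.+1 \is a GRing.unit.
Proof. by have := qpochp_unit n.+1; rewrite qpochpS unitrM => /andP[]. Qed.

Lemma bailey_weight_step k m : c (k + m).+1 m * (1 - p ^+ k.+1) =
  c (k + m).+1 m.+1 * (1 - p ^+ ((k + m).+1 + m).+1).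
Proof.
rewrite /c (_ : (k + m).+1 - m = k.+1)%N; last by lia.
rewrite (_ : (k + m).+1 - m.+1 = k)%N; last by lia.
rewrite addnS; move: ((k + m).+1 + m)%N => l.
have -> : P k.+1 = P k * (1 - p ^+ k.+1) := qpochpS k.
have -> : P l.+1 = P l * (1 - p ^+ l.+1) := qpochpS l.
have [uk ul] := (one_subX_unit k, one_subX_unit l).
have uPk := qpochp_unit k; have uPl := qpochp_unit l.
rewrite mulrAC [X in X^-1 * _ = _]mulrC [LHS]mulrC unit_fracK ?unitrM ?uPk //.
by rewrite mulrA [RHS]mulrC [X in _ / X]mulrC unit_fracK ?unitrM ?uPk.
Qed.

(** The partial sums of [unit_sum] have a closed form. It carries the factor
    1 - p^(n-m), which vanishes for m = n. *)
Lemma unit_sum_partial n m : (m <= n)%N ->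
  (1 - p ^+ n) * (c n 0 + \sum_(r < m)
     (-1) ^+ r.+1 * (p ^+ 'C(r.+1, 2) + p ^+ 'C(r.+2, 2)) * c n r.+1)
  = (-1) ^+ m * p ^+ 'C(m.+1, 2) * (1 - p ^+ (n - m)) * c n m.
Proof.
elim: m => [|m IH] mn; first by rewrite big_ord0 addr0 subn0 !mul1r.
rewrite big_ord_recr /= addrA mulrDr IH; last exact: ltnW.
have [k nE] : exists k, n = (k + m).+1 by exists (n - m.+1)%N; lia.
subst n; rewrite (_ : (k + m).+1 - m = k.+1)%N; last by lia.
rewrite (_ : (k + m).+1 - m.+1 = k)%N; last by lia.
rewrite -[X in X + _]mulrA [(1 - _) * c _ m]mulrC bailey_weight_step.
rewrite (binS m.+1) bin1 (_ : ((k + m).+1 + m).+1 = k + m.+1 + m.+1)%N; last by lia.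
rewrite (_ : (k + m).+1 = k + m.+1)%N; last by lia.
by rewrite !exprD [(-1) ^+ m.+1]exprS; ring.
Qed.

(** The unit Bailey pair relative to 1: the transform of
    (-1)^r (p^C(r,2) + p^C(r+1,2)) vanishes at every positive
    index. *)
Lemma unit_sum n :
  c n.+1 0 + \sum_(r < n.+1)
     (-1) ^+ r.+1 * (p ^+ 'C(r.+1, 2) + p ^+ 'C(r.+2, 2)) * c n.+1 r.+1 = 0.
Proof.
apply: (mulrI (one_subX_unit n)).
by rewrite unit_sum_partial // subnn subrr mulr0 mul0r mulr0.
Qed.

Variables (b1 b2 K : fps int) (al si ta : nat -> fps int).
Hypothesis H0 : si 0%N = K.

(** For all n at once, the terms of B_n (1 - b1 p^n + b2 p^(2n)) - B_(n-1) have to be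
    p^n (si_r c_(n,r) - ta_r c_(n,r+1)), with c the weights of the unit pair. This is
    an identity between polynomials in p^n; its two coefficients are [H1] and [H2].
    Summation by parts then leaves si_(r+1) - ta_r as the coefficient of
    c_(n,r+1), and [H3] makes this a multiple of the unit pair. *)
Hypothesis H1 : forall r,
  p ^+ r * (si r - ta r) = al r * (1 + p ^+ (2 * r).+1 - b1 * p ^+ r).
Hypothesis H2 : forall r,
  p ^+ (2 * r).+1 * si r - ta r = al r * p ^+ r * (p - b2).
Hypothesis H3 : forall r, si r.+1 - ta r =
  K * (-1) ^+ r.+1 * (p ^+ 'C(r.+1, 2) + p ^+ 'C(r.+2, 2)).
Definition bailey n := \sum_(r < n.+1) al r / (P (n - r) * P (n + r).+1).

Lemma bailey_step n :
  bailey n.+1 * (1 - b1 * p ^+ n.+1 + b2 * p ^+ (2 * n.+1)) = bailey n.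
Proof.
set den := (X in _ * X); set N := n.+1.
pose w r := (P (N - r) * P (N + r).+1)^-1.
pose d r := (1 - p ^+ (N - r)) * w r.
have cE r : c N r = (1 - p ^+ (N + r).+1) * w r.
  by rewrite /c /w qpochpS mulrA [_ * (1 - _)]mulrC unit_fracK ?unitrM ?qpochp_unit ?one_subX_unit.
have wE r : (r < N)%N -> w r = (P (N - r.+1) * P (N + r) * ((1 - p ^+ (N - r)) * (1 - p ^+ (N + r).+1)))^-1.
  move=> rN; rewrite /w qpochpS (_ : N - r = (N - r.+1).+1)%N; last by lia.
  by rewrite qpochpS; congr (_^-1); ring.
have dE r : (r < N)%N -> d r = c N r.+1.
  move=> rN; rewrite /d /w /c addnS (_ : N - r = (N - r.+1).+1)%N; last by lia.
  by rewrite qpochpS -mulrA mulrCA unit_fracK ?unitrM ?qpochp_unit ?one_subX_unit.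
(* The identity of [H1] and [H2]: z = p^(N-r) is the variable, and the coefficients
   of z and z^2 are e1 and e2 up to a factor. *)
have termE r : (r <= N)%N -> al r * w r * den -
    al r * ((1 - p ^+ (N - r)) * (1 - p ^+ (N + r).+1)) * w r =
    p ^+ N * (si r * c N r - ta r * d r).
  move=> rN; rewrite cE /d /den -/N; have [k NE] : exists k, N = (k + r)%N.
    by exists (N - r)%N; lia.
  have /eqP := H1 r; rewrite -subr_eq0 => /eqP E1.
  have /eqP := H2 r; rewrite -subr_eq0 => /eqP E2.
  move: (w r) E1 E2 => W; rewrite NE addnK (_ : (k + r + r).+1 = k + (2 * r).+1)%N; last by lia.
  rewrite (_ : (2 * r).+1 = r + r + 1)%N; last by lia.
  rewrite mulnDr (_ : 2 * k = k + k)%N; last by lia.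
  rewrite (_ : 2 * r = r + r)%N; last by lia.
  rewrite !exprD expr1; set y := p ^+ r; set z := p ^+ k => E1 E2.
  set e1 := (X in X = 0) in E1; set e2 := (X in X = 0) in E2.
  transitivity (z * y * (si r * ((1 - z * (y * y * p)) * W) - ta r * ((1 - z) * W))
    - W * z * e1 + W * z * z * y * e2); first by rewrite /e1 /e2; ring.
  by rewrite E1 E2 !mulr0 subr0 addr0.
have lastE : \sum_(r < N) al r * ((1 - p ^+ (N - r)) * (1 - p ^+ (N + r).+1)) * w r = bailey n.
  apply: eq_bigr => -[r rN] _ /=; rewrite wE // (_ : N - r.+1 = n - r)%N; last by rewrite /N; lia.
  rewrite -mulrA; congr (_ * _); rewrite [X in _ / X]mulrC unit_fracK //.
    by rewrite unitrM; apply/andP; split; [rewrite (_ : N - r = (n - r).+1)%N ?one_subX_unit //; lia|exact: one_subX_unit].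
  by rewrite unitrM !qpochp_unit.
(* The term r = N has the factor 1 - p^0 = 0, so B_n can be summed over the range
   of B_N. *)
have fullE : \sum_(r < N.+1) al r * ((1 - p ^+ (N - r)) * (1 - p ^+ (N + r).+1)) * w r = bailey n.
  by rewrite big_ord_recr /= lastE subnn subrr mul0r mulr0 mul0r addr0.
apply/eqP; rewrite -subr_eq0 -fullE /bailey mulr_suml -sumrB.
rewrite (eq_bigr (fun r : 'I_N.+1 => p ^+ N * (si r * c N r - ta r * d r))); last first.
  by move=> -[r rN] _; rewrite -termE.
rewrite -mulr_sumr sumrB big_ord_recl [X in _ - X]big_ord_recr /= {2}/d subnn subrr mul0r mulr0 addr0.
rewrite -addrA -sumrB H0.
rewrite (eq_bigr (fun r : 'I_N => K * ((-1) ^+ r.+1 * (p ^+ 'C(r.+1, 2) + p ^+ 'C(r.+2, 2)) * c N r.+1))); last first.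
  by move=> -[r rN] _ /=; rewrite dE // -mulrBl H3; ring.
by rewrite -mulr_sumr -mulrDr unit_sum mulr0 mulr0.
Qed.

Let den n : fps int := \prod_(i < n) (1 - b1 * p ^+ i.+1 + b2 * p ^+ (2 * i.+1)).

Lemma bailey_den n : bailey n * den n = al 0 / (1 - p).
Proof.
elim: n => [|n IH].
  rewrite /den big_ord0 mulr1 /bailey big_ord_recl big_ord0 addr0 /=.
  by rewrite /P qpoch0 mul1r /qpoch big_ord_recl big_ord0 mulr1 mulr1.
by rewrite /den big_ord_recr /= -/(den n) mulrCA bailey_step mulrC IH.
Qed.

Hypothesis al0 : forall r, eqm r (al r) 0.

Lemma bailey_cv : cv bailey (ssum al / pinf p p ^+ 2).
Proof.
have uI : pinf p p \is a GRing.unit by exact: pinf_unit.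
have cP := cv_pinf p p0.
apply: cv_eqm (cv_mul (cv_ssum al0) (cv_cst (pinf p p ^+ 2)^-1)) _ => n.
rewrite mulr_suml /bailey big_ord_recr /= -[X in eqm _ X _]addr0.
apply: eqmD; last by apply/eqm_sym/eqm0Ml/al0.
apply: eqm_sum => -[r rn] _ /=; apply: (@eqm_mull r); [exact: ltnW | exact: al0 |].
apply: eqmV; rewrite ?unitrX ?unitrM ?qpochp_unit //.
rewrite expr2; apply/eqm_sym/eqmM; first exact: cP.
apply: eqmW (cP (n + r).+1) _; lia.
Qed.

(** Let n tend to infinity in [bailey_den]; the r-th term of B_n tends to
    al_r / (p; p)_oo^2, uniformly enough because al_r is divisible by q^r. *)
Lemma bailey_limit D : cv den D -> ssum al * D * (1 - p) = al 0 * pinf p p ^+ 2.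
Proof.
move=> cD; have uI : pinf p p ^+ 2 \is a GRing.unit by rewrite unitrX // pinf_unit.
have u1 := one_subX_unit 0; rewrite expr1 in u1.
have := cv_uniq (cv_mul bailey_cv cD) (cv_ext (cv_cst (al 0 / (1 - p))) _).
move=> /(_ (fun n => esym (bailey_den n))) E.
rewrite -[ssum al](divrK uI); set T := ssum al / _ in E *.
transitivity (T * D * (1 - p) * pinf p p ^+ 2); first by ring.
by rewrite E divrK.
Qed.

End Bailey.

(** * Theta functions: products and lattice identities *)

Section Gauss.

Variables (y : fps int) (y0 : coef y 0 = 0).

Lemma coef0sq : coef (y ^+ 2) 0 = 0. Proof. by rewrite coef0X. Qed.

(** With r and -r-1 grouped: the triangular numbers of index 2r and 2r+1 are
    2r^2 + r and (2r^2 + r) + (2r + 1). *)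
Definition psi_term r := y ^+ (4 * 'C(r, 2) + 3 * r) * (1 + y ^+ (2 * r).+1).

(** Gauss's product for psi, by the telescoping lemma with base p = y^2 and ratios
    1 - (1+y) p^n + y p^(2n) = (1 - p^n) (1 - y p^n). Here K = 0. *)
Lemma psi_product : ssum psi_term * pinf y (y ^+ 2) = pinf (y ^+ 2) (y ^+ 2).
Proof.
(* X r = y^(r(2r-1)), so that al r, si r and ta r are multiples of X r. *)
pose X r := y ^+ (4 * 'C(r, 2) + r).
pose si r := X r * (1 - y ^+ (2 * r)).
pose ta r := X r * y ^+ (4 * r).+1 * (1 - y ^+ (2 * r.+1)).
have p0 := coef0sq; set p := y ^+ 2 in p0 *.
have alE r : psi_term r = X r * y ^+ (2 * r) * (1 + y ^+ (2 * r).+1).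
  by rewrite /psi_term /X -exprD; congr (y ^+ _ * _); lia.
have yp r : p ^+ r = y ^+ r * y ^+ r by rewrite /p -exprM mul2n -addnn exprD.
have y2 r : y ^+ (2 * r) = y ^+ r * y ^+ r by rewrite mul2n -addnn exprD.
have -> : pinf p p = ssum psi_term * (pinf p p * pinf (y * p) p) * (1 - p)
    * (pinf p p)^-1 * (1 + y)^-1.
  rewrite (@bailey_limit p p0 (1 + y) y 0 psi_term si ta) //.
  - rewrite {1}/psi_term bin0n /= expr0 mul1r expr1 expr2.
    have u1 : 1 + y \is a GRing.unit by apply: unit_coef1; rewrite coef_fpsD y0 addr0.
    have u2 : pinf p p \is a GRing.unit by apply: pinf_unit.
    by rewrite mulrA mulrK // mulrC mulKr.
  - by rewrite /si muln0 expr0 subrr mulr0.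
  - move=> r; rewrite alE /si /ta !yp (_ : 4 * r = r + r + r + r)%N; last by lia.
    rewrite ?(y2 r.+1) ![y ^+ _.+1]exprS ?exprD ?y2; ring.
  - move=> r; rewrite alE /si /ta !yp (_ : 4 * r = r + r + r + r)%N; last by lia.
    rewrite ?(y2 r.+1) ![y ^+ _.+1]exprS ?exprD ?y2 /p; ring.
  - move=> r; rewrite !mul0r /si /ta /X binS bin1.
    rewrite (_ : 4 * ('C(r, 2) + r) + r.+1 = 4 * 'C(r, 2) + r + (4 * r).+1)%N; last by lia.
    by rewrite exprD; ring.
  - move=> r; rewrite alE -mulrA; apply: eqm0Mr; apply: eqm0Ml; apply: eqm0Xk => //; lia.
  apply: cv_ext (cv_mul (cv_pinf p p0) (cv_pinf (y * p) p0)) _ => n.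
  rewrite /qpoch -big_split; apply: eq_bigr => i _ /=.
  by rewrite mul2n -addnn exprD !exprS; ring.
rewrite (pinf_split y 1 p0) {1}/qpoch big_ord1 expr0 expr1 mulr1.
have u1 : 1 + y \is a GRing.unit by apply: unit_coef1; rewrite coef_fpsD y0 addr0.
have u2 : pinf p p \is a GRing.unit by apply: pinf_unit.
apply: (mulIr u1); apply: (mulIr u2).
rewrite divrK // divrK // /p; ring.
Qed.

End Gauss.

(** Gauss's product for phi(-p), by the telescoping lemma with ratios
    1 - p^(2n) and K = 0. *)
Lemma phi_product (p : fps int) : coef p 0 = 0 ->
  ssum (fun r => (-1) ^+ r * p ^+ (2 * 'C(r, 2) + r) * (1 - p ^+ (2 * r).+1))
    * pinf (p ^+ 2) (p ^+ 2) = pinf p p ^+ 2.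
Proof.
move=> p0; set al := fun r => _.
pose X r := (-1) ^+ r * p ^+ (2 * 'C(r, 2)).
pose si r := X r * (1 - p ^+ (2 * r)).
pose ta r := - X r * p ^+ (2 * r) * (1 - p ^+ (2 * r.+1)).
have y2 r : p ^+ (2 * r) = p ^+ r * p ^+ r by rewrite mul2n -addnn exprD.
have alE r : al r = X r * p ^+ r * (1 - p ^+ (2 * r).+1).
  by rewrite /al /X exprD; ring.
have u1 : 1 - p \is a GRing.unit.
  by apply: unit_coef1; rewrite coef_fpsD coef_fpsN p0 oppr0 addr0.
apply: (mulIr u1); have a0 : al 0 = 1 - p by rewrite /al bin0n /= !expr0 !mul1r expr1.
rewrite [RHS]mulrC -[X in _ = X * _]a0.
have p20 : coef (p ^+ 2) 0 = 0 by rewrite coef0X.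
apply: (@bailey_limit p p0 0 (-1) 0 al si ta) => //.
- by rewrite /si muln0 expr0 subrr mulr0.
- by move=> r; rewrite alE /si /ta (y2 r.+1) ![p ^+ _.+1]exprS !y2; ring.
- by move=> r; rewrite alE /si /ta (y2 r.+1) ![p ^+ _.+1]exprS !y2; ring.
- move=> r; rewrite !mul0r /si /ta /X binS bin1 mulnDr exprD exprS; ring.
- move=> r; rewrite alE -mulrA; apply: eqm0Mr; apply: eqm0Ml; apply: eqm0Xk => //; lia.
apply: cv_ext (cv_pinf (p ^+ 2) p20) _ => n.
rewrite /qpoch; apply: eq_bigr => i _ /=.
by rewrite -exprM -exprD mul0r subr0 mulN1r mulnS addnC.
Qed.

(** Coefficients at integer indices, so that exponents can be subtracted freely. *)
Definition coefz f (z : int) : int := if z is Posz n then coef f n else 0.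

(** The series sum_t w(t) q^(e t) over all integers t. *)
HB.lock Definition theta (w e : int -> int) : fps int :=
  Fps (fun N => zsum (fun t => if e t == N%:Z then w t else 0)).

(** A bound linear in |t| is all that is used of the quadratic exponents: it makes
    every coefficient a finite sum with a computable range. *)
Definition dominating (e : int -> int) := forall t : int, `|t| <= e t.

Lemma coef_theta w e N :
  coef (theta w e) N = zsum (fun t => if e t == N%:Z then w t else 0).
Proof. by rewrite theta.unlock. Qed.

Lemma theta_supp w e N : dominating e ->
  supported N (fun t => if e t == N%:Z then w t else 0).
Proof. by move=> de t; have := de t; case: (e t =P N%:Z) => [->|_]; [lia | rewrite eqxx]. Qed.

Lemma coef_thetaM w e f N : dominating e ->
  coef (theta w e * f) N = zsum (fun t => w t * coefz f (N%:Z - e t)).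
Proof.
move=> de; rewrite coef_fpsM (@zsum_box N); last first.
  move=> t; have := de t; case E : (N%:Z - e t) => [n|n]; last by rewrite mulr0.
  by move: E; lia.
rewrite (eq_bigr (fun i : 'I_N.+1 => boxsum
  (fun t => (if e t == i%:Z then w t else 0) * coef f (N - i)) N)); last first.
  move=> i _; rewrite coef_theta (@zsum_box N) ?boxsum_mulr //.
  by apply: supportedW (@theta_supp w e i de) _; have := ltn_ord i; lia.
rewrite (boxsum_exchange _ (fun i t => (if e t == i%:Z then w t else 0) * coef f (N - i))).
apply: eq_boxsum => t; have et := de t.
have [k ek] : exists k, e t = Posz k by case: (e t) et => [k|k]; [exists k | lia].
rewrite ek; case: (leqP k N) => kN.
  have kN1 : (k < N.+1)%N by [].
  rewrite (bigD1 (Ordinal kN1)) //= eqxx big1 ?addr0; last first.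
    move=> i /eqP ni; case: eqP => [[E]|]; last by rewrite mul0r.
    by case: ni; apply: val_inj.
  by congr (_ * _); rewrite (_ : N%:Z - k%:Z = (N - k)%N%:Z) //; lia.
rewrite big1; last by move=> i _; case: eqP => [[E]|]; rewrite ?mul0r //; have := ltn_ord i; lia.
by case E : (_ - _) => [n|n]; [lia | rewrite mulr0].
Qed.

(** Pairs t = r with t = -r-1, which is how Gauss groups the terms of phi and psi. *)
Lemma ssum_theta u w e : dominating e ->
  (forall r, u r = mono (w (Posz r)) (e (Posz r)) + mono (w (Negz r)) (e (Negz r))) ->
  ssum u = theta w e.
Proof.
move=> de uE; apply/fpsP => N; rewrite coef_ssum coef_theta (@zsum_pairs N.+1); last first.
  by move=> i /(@theta_supp w e N de).
by apply: eq_bigr => r _; rewrite uE.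
Qed.

(** phi(-q^k), phi(q^k), psi(-q^k) and psi(q^k). For psi, the numbers 2t^2 + t with t
    an integer are the triangular numbers, each once, and (-1)^t is -1
    to that power. *)
Definition phi_neg k := theta sg (fun t => k%:Z * (t * t)).
Definition phi_pos k := theta (fun=> 1) (fun t => k%:Z * (t * t)).
Definition psi_neg k := theta sg (fun t => k%:Z * (2 * t * t + t)).
Definition psi_pos k := theta (fun=> 1) (fun t => k%:Z * (2 * t * t + t)).

Lemma dom_phi k : (0 < k)%N -> dominating (fun t => k%:Z * (t * t)).
Proof. by move=> k0 t; nia. Qed.

Lemma dom_psi k : (0 < k)%N -> dominating (fun t => k%:Z * (2 * t * t + t)).
Proof.
move=> k0 t; have : `|t| <= 2 * t * t + t by nia.
by nia.
Qed.

Lemma phi_neg_product k : (0 < k)%N -> phi_neg k * ell (2 * k) = ell k ^+ 2.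
Proof.
move=> k0; have := phi_product (coef0q k0).
rewrite -exprM [(k * 2)%N]mulnC !ellE => <-; congr (_ * _).
apply/esym/(ssum_theta (dom_phi k0)) => r.
have -> : (2 * 'C(r, 2) + r = r * r)%N.
  by case: r => [|r] //; have := bin2_double r; lia.
rewrite sgNegz /sg /= mulrBr mulr1 -mulrA -exprD -!exprM !qXn monoN -!mono_sign.
by congr (mono _ _ - mono _ _); rewrite ?NegzE; lia.
Qed.

Lemma psi_exponent r : (4 * 'C(r, 2) + 3 * r = 2 * r * r + r)%N.
Proof. by case: r => [|r] //; have := bin2_double r; lia. Qed.

Lemma psi_pos_product k : (0 < k)%N -> psi_pos k * ell k = ell (2 * k) ^+ 2.
Proof.
move=> k0; have E := psi_product (coef0q k0).
rewrite -exprM [(k * 2)%N]mulnC ellE in E.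
have F : ssum (psi_term (q ^+ k)) = psi_pos k.
  apply: (ssum_theta (dom_psi k0)) => r.
  rewrite /psi_term mulrDr mulr1 -exprD -!exprM !qXn psi_exponent.
  by congr (mono _ _ + mono _ _); rewrite ?NegzE; lia.
by rewrite -(pinf_odd k0) mulrA -F E expr2; reflexivity.
Qed.

(** The substitution of -q^k for q^k in the product of psi. *)
Lemma psi_neg_product k : (0 < k)%N -> psi_neg k * ell (2 * k) = ell k * ell (4 * k).
Proof.
move=> k0; have c0 : coef (- q ^+ k) 0 = 0 by rewrite coef_fpsN coef0q // oppr0.
have := psi_product c0; rewrite sqrrN -exprM [(k * 2)%N]mulnC ellE => E.
have F : ssum (psi_term (- q ^+ k)) = psi_neg k.
  apply: (ssum_theta (dom_psi k0)) => r.
  have s1 : (-1) ^+ (2 * r * r + r) = (-1) ^+ r :> fps int.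
    by rewrite exprD -mulnA exprM sqrrN expr1n expr1n mul1r.
  have s2 : (-1) ^+ (2 * r * r + r + (2 * r).+1) = - (-1) ^+ r :> fps int.
    by rewrite exprD s1 exprS exprM sqrrN expr1n expr1n mulr1 mulrN1.
  rewrite /psi_term mulrDr mulr1 -exprD psi_exponent ![(- q ^+ k) ^+ _]exprNn s1 s2.
  rewrite -!exprM !qXn sgNegz /sg /= monoN mulNr -!mono_sign.
  by congr (mono _ _ - mono _ _); rewrite ?NegzE; lia.
have u : ell (2 * k) \is a GRing.unit by apply: ell_unit; lia.
apply: (mulIr u); rewrite -[LHS]mulrA -expr2 -(pinf_odd_neg k0) [LHS]mulrA -F E mulrC.
reflexivity.
Qed.

Lemma coefz_theta w e z : dominating e ->
  coefz (theta w e) z = zsum (fun t => if e t == z then w t else 0).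
Proof.
move=> de; case: z => n; first exact: coef_theta.
by apply/esym/zsum0 => t; have := de t; case: eqP => // ->; lia.
Qed.

Lemma coef_theta2 w e w' e' N : dominating e -> dominating e' ->
  coef (theta w e * theta w' e') N =
  zsum (fun t => zsum (fun s => if e t + e' s == N%:Z then w t * w' s else 0)).
Proof.
move=> de de'; rewrite coef_thetaM //; apply: eq_zsum => t.
rewrite coefz_theta // -zsumM; apply: eq_zsum => s.
rewrite (_ : (e' s == N%:Z - e t) = (e t + e' s == N%:Z)); last by apply/eqP/eqP; lia.
by case: ifP; rewrite ?mulr0.
Qed.

Lemma coefz_theta2 w e w' e' z : dominating e -> dominating e' ->
  coefz (theta w e * theta w' e') z =
  zsum (fun t => zsum (fun s => if e t + e' s == z then w t * w' s else 0)).
Proof.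
move=> de de'; case: z => n; first exact: coef_theta2.
apply/esym/zsum0 => t; apply: zsum0 => s; have := de t; have := de' s.
by case: (_ =P Negz n) => // E; lia.
Qed.

Lemma coef_2qM f N : coef (2 * (q * f)) N = 2 * coefz f (N%:Z - 1).
Proof.
have -> : 2 * (q * f) = q * (f + f) by ring.
rewrite coef_fpsXM; case: N => [|N]; first by rewrite mulr0.
by rewrite (_ : N.+1%:Z - 1 = N%:Z) ?coef_fpsD /=; lia.
Qed.

Lemma ind_nz (e z w : int) : (if e == z then w else 0) != 0 -> e = z.
Proof. by case: (e =P z) => //; rewrite eqxx. Qed.

Lemma theta2_nz e e' (N : nat) (t s w : int) : dominating e -> dominating e' ->
  (if e t + e' s == N%:Z then w else 0) != 0 -> (`|t| <= N)%N /\ (`|s| <= N)%N.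
Proof. by move=> de de' /ind_nz; have := de t; have := de' s; lia. Qed.

(** In psi(q)^2 the pairs (x, y) are sorted by the parity of y - x. With
    u = x + y and z = y - x the exponent 2x^2 + x + 2y^2 + y is z^2 + u(u+1), where
    u = z modulo 2; for u = 2s and for u = -2s - 1 the number u(u+1) is 2(2s^2 + s),
    as in phi(q) psi(q^2). *)
Lemma phi_psi : phi_pos 1 * psi_pos 2 = psi_pos 1 * psi_pos 1.
Proof.
have p1 := @dom_phi 1 isT; have s1 := @dom_psi 1 isT; have s2 := @dom_psi 2 isT.
apply/fpsP => N; rewrite /phi_pos /psi_pos.
rewrite !coef_theta2; try by [exact: dom_phi | exact: dom_psi].
rewrite (zsum_parity (_ : bounded _)); last first.
  by apply: (@bounded_zsum _ N) => x y /(theta2_nz p1 s2); lia.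
rewrite [RHS](@zsum_shear N); last by move=> x y /(theta2_nz s1 s1).
rewrite [RHS]zsum_parity; last first.
  by apply: (@bounded_zsum _ (2 * N)) => x y /(theta2_nz s1 s1); lia.
congr (_ + _).
  rewrite [RHS](zflip 0); apply: eq_zsum => z; rewrite [RHS](zshift z); apply: eq_zsum => y.
  by congr (if _ then _ else _); apply/eqP/eqP; lia.
rewrite [RHS](zflip (-1)); apply: eq_zsum => z; rewrite [RHS](zflip z); apply: eq_zsum => y.
by congr (if _ then _ else _); apply/eqP/eqP; lia.
Qed.

(** On the right the form is y^2 + 3x^2 with sign (-1)^x; write y = x + d. For odd d
    the two residues of d modulo 4 give two equal copies of q psi(-q^2) psi(-q^6).
    For d = 2 modulo 4 the involution (x, y) -> (-d/2 - x, d/2 - x) preserves the form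
    and changes the sign, so these terms cancel. For d = 0 modulo 4 the form becomes
    4X^2 + 12Y^2 with Y = d/4 and X = x + Y. *)
Lemma phi_hex : phi_neg 4 * phi_neg 12 + 2 * (q * (psi_neg 2 * psi_neg 6)) = phi_pos 1 * phi_neg 3.
Proof.
have p1 := @dom_phi 1 isT; have p3 := @dom_phi 3 isT.
have p4 := @dom_phi 4 isT; have p12 := @dom_phi 12 isT.
apply/fpsP => N; rewrite coef_fpsD.
have s2 := @dom_psi 2 isT; have s6 := @dom_psi 6 isT.
rewrite coef_2qM /psi_neg coefz_theta2 //.
rewrite /phi_pos /phi_neg !coef_theta2; try by exact: dom_phi.
apply/esym; rewrite [LHS](@zsum_exchange N); last by move=> x y /(theta2_nz p1 p3).
rewrite [LHS](@zsum_shear N); last by move=> x y /(theta2_nz p1 p3) [].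
rewrite [LHS]zsum_parity; last first.
  by apply: (@bounded_zsum _ (2 * N)) => x y /(theta2_nz p1 p3); lia.
congr (_ + _).
  rewrite [LHS]zsum_parity; last first.
    by apply: (@bounded_zsum _ (2 * N)) => x y /(theta2_nz p1 p3); lia.
  rewrite [X in _ + X = _]zsum0 ?addr0; last first.
    move=> y; apply: (@zsum_anti (fun x => - (2 * y + 1) - x)) => x; first lia.
    rewrite (_ : sg (- (2 * y + 1) - x) = - sg x); last first.
      by rewrite sgD !sgN sg_odd mulN1r.
    rewrite mul1r mul1r (_ : (_ == N%:Z) = (1%N%:Z * ((x + 2 * (2 * y + 1)) * (x + 2 * (2 * y + 1))) + 3%N%:Z * (x * x) == N%:Z)); last by apply/eqP/eqP; lia.
    by case: ifP; rewrite ?oppr0.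
  rewrite [RHS](@zsum_exchange N); last by move=> x y /(theta2_nz p4 p12).
  apply: eq_zsum => y; rewrite [LHS](zshift (- y)); apply: eq_zsum => x.
  rewrite mul1r sgD sgN mulrC.
  by congr (if _ then _ else _); apply/eqP/eqP; lia.
rewrite [LHS]zsum_parity; last first.
  by apply: (@bounded_zsum _ (2 * N)) => x y /(theta2_nz p1 p3); lia.
rewrite [X in _ = 2 * X](@zsum_exchange N); last first.
  by move=> x y /ind_nz; have := s2 x; have := s6 y; lia.
set Z := (X in _ = 2 * X); rewrite (_ : 2 * Z = Z + Z); last by lia.
congr (_ + _).
  apply: eq_zsum => y; rewrite [LHS](zshift (- y)); apply: eq_zsum => x.
  rewrite mul1r sgD sgN mulrC.
  by congr (if _ then _ else _); apply/eqP/eqP; lia.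
rewrite [LHS](zflip (-1)); apply: eq_zsum => y; rewrite [LHS](zflip y); apply: eq_zsum => x.
rewrite mul1r sgD sgN mulrC.
by congr (if _ then _ else _); apply/eqP/eqP; lia.
Qed.

(** * Two sums of Hecke type that are products *)

(** A finite theta sum over |j| <= r. The rows of a Hecke-type sum satisfy
    first-order recurrences in r, because raising r shifts the exponents by a
    constant and adds the two terms j = r+1 and j = -r-1. *)
Definition theta_row (w e : int -> int) r := boxsum (fun j => mono (w j) (e j)) r.

Lemma theta_row_shift d w e r : (forall j : int, (`|j| <= r)%N -> 0 <= e j) ->
  q ^+ d * theta_row w e r = theta_row w (fun j => d%:Z + e j) r.
Proof.
move=> e0; rewrite /theta_row /boxsum mulrDr !mulr_sumr.
congr (_ + _); apply: eq_bigr => j _; apply: mono_shift; apply: e0; have := ltn_ord j; lia.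
Qed.

Lemma eq_theta_row w e e' r : e =1 e' -> theta_row w e r = theta_row w e' r.
Proof. by move=> ee; congr (_ + _); apply: eq_bigr => j _; rewrite ee. Qed.

Definition hecke_pronic_row k r := theta_row (fun=> 1) (fun j => k%:Z * (2 * r%:Z ^+ 2 - j * (j + 1))) r.

(** sum_r (-1)^r Q^(2r(r+1)) sum_(|i| <= r) Q^(-i(i+1)) with Q = q^k. The power 2kr
    is kept outside the row: it shows that the r-th term is divisible by q^r, and the
    row without it satisfies the recurrence that the telescoping lemma asks for. *)
Definition hecke_pronic k := ssum (fun r => (-1) ^+ r * (q ^+ (2 * k * r) * hecke_pronic_row k r)).

(** The telescoping lemma with base p = q^(2k), ratios 1 - p^(2n+1) and K = 1; the
    two new terms of a row are exactly those of the unit pair. *)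
Lemma hecke_pronic_product k : (0 < k)%N -> hecke_pronic k = ell (2 * k) * ell (4 * k).
Proof.
move=> k0; set p := q ^+ (2 * k).
have p0 : coef p 0 = 0 by rewrite coef0q //; lia.
pose X r := (-1) ^+ r * hecke_pronic_row k r.
pose al r := (-1) ^+ r * (q ^+ (2 * k * r) * hecke_pronic_row k r).
pose ta r := - (p ^+ (2 * r).+1) * X r.
have y2 r : p ^+ (2 * r) = p ^+ r * p ^+ r by rewrite mul2n -addnn exprD.
have alE r : al r = p ^+ r * X r by rewrite /al /X /p -exprM; ring.
have p20 : coef (p ^+ 2) 0 = 0 by rewrite coef0X.
have X0 : X 0 = 1.
  rewrite /X /hecke_pronic_row /theta_row /boxsum big_ord1 big_ord0 addr0 mul1r.
  by rewrite (_ : _ - _ = 0) ?mulr0 //; apply/esym; rewrite -(expr0 q) qXn.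
have L : ssum al * pinf (p * p ^+ 2) (p ^+ 2) * (1 - p) = al 0 * pinf p p ^+ 2.
  apply: (@bailey_limit p p0 0 (- p) 1 al X ta) => //.
  - by move=> r; rewrite alE /ta ![p ^+ _.+1]exprS !y2; ring.
  - by move=> r; rewrite alE /ta ![p ^+ _.+1]exprS !y2; ring.
  - move=> r; rewrite /ta /X /hecke_pronic_row.
    have -> : theta_row (fun=> 1) (fun j => k%:Z * (2 * r.+1%:Z ^+ 2 - j * (j + 1))) r.+1
      = p ^+ (2 * r).+1 * hecke_pronic_row k r + (p ^+ 'C(r.+1, 2) + p ^+ 'C(r.+2, 2)).
      rewrite {1}/theta_row boxsumS -/(theta_row _ _ _); congr (_ + _).
        rewrite /hecke_pronic_row /p -exprM theta_row_shift; last first.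
          by move=> j jr; apply: mulr_ge0 => //; have := pronic_bound jr; nia.
        by apply: eq_theta_row => j; lia.
      have C2 m : (2 * k * 'C(m.+1, 2) = k * (m * m.+1))%N by rewrite -bin2_double; lia.
      rewrite /p -!exprM !qXn !C2; congr (mono _ _ + mono _ _).
      + by lia.
      + by lia.
    by rewrite /hecke_pronic_row exprS; ring.
  - move=> r; rewrite alE; apply: eqm0Ml; exact: eqm0X.
  apply: cv_ext (cv_pinf (p * p ^+ 2) p20) _ => n.
  rewrite /qpoch; apply: eq_bigr => i _ /=.
  rewrite -(exprM p 2 i) (_ : 2 * i.+1 = 2 + 2 * i)%N; last by lia.
  by rewrite exprD; ring.
have := pinf_split p 1 p20; rewrite {1}/qpoch big_ord1 expr0 expr1 mulr1 => E.
have a0 : al 0 = 1 by rewrite alE X0 expr0 mulr1.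
have L2 : ssum al * pinf p (p ^+ 2) = pinf p p ^+ 2.
  rewrite E [(1 - p) * _]mulrC mulrA; rewrite a0 mul1r in L; exact: L.
have k20 : (0 < 2 * k)%N by lia.
have O : pinf p (p ^+ 2) * ell (4 * k) = ell (2 * k).
  rewrite /p -exprM [(2 * k * 2)%N]mulnC (_ : 4 * k = 2 * (2 * k))%N; last by lia.
  exact: pinf_odd.
have Lk : pinf p p = ell (2 * k) by rewrite /p ellE.
have VE : hecke_pronic k = ssum al by [].
apply: (mulrI (ell_unit k20)); rewrite -{1}O VE.
transitivity (ssum al * pinf p (p ^+ 2) * ell (4 * k)).
  rewrite [LHS]mulrC mulrA; reflexivity.
rewrite L2 Lk expr2 mulrA; reflexivity.
Qed.

Definition hecke_square_row k r := theta_row (fun=> 1) (fun j => k%:Z * (2 * r%:Z ^+ 2 - r%:Z - j * j)) r.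

(** sum_r (-1)^r Q^(2r^2 + r) (1 + Q^(2r+1)) sum_(|i| <= r) Q^(-i^2) with Q = q^k. *)
Definition hecke_square k :=
  ssum (fun r => (-1) ^+ r * (q ^+ (2 * k * r) * (1 + q ^+ (k * (2 * r).+1)) * hecke_square_row k r)).

(** The telescoping lemma with x = q^k, base p = x^2, ratios
    1 - (x-1) p^n - x p^(2n) = (1 - x p^n) (1 + p^n) and K = 2. *)
Lemma hecke_square_product k : (0 < k)%N -> hecke_square k * (ell k * ell (4 * k)) = ell (2 * k) ^+ 4.
Proof.
move=> k0; pose x := q ^+ k; pose p := x ^+ 2.
have x0 : coef x 0 = 0 by rewrite coef0q.
have p0 : coef p 0 = 0 by rewrite coef0X.
pose X r := (-1) ^+ r * hecke_square_row k r.
pose al r := (-1) ^+ r * (q ^+ (2 * k * r) * (1 + q ^+ (k * (2 * r).+1)) * hecke_square_row k r).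
pose si r := (1 + x ^+ (2 * r)) * X r.
pose ta r := - x ^+ (4 * r).+1 * (1 + x ^+ (2 * r.+1)) * X r.
have px r : p ^+ r = x ^+ r * x ^+ r by rewrite /p -exprM mul2n -addnn exprD.
have x2 r : x ^+ (2 * r) = x ^+ r * x ^+ r by rewrite mul2n -addnn exprD.
have alE r : al r = x ^+ (2 * r) * (1 + x ^+ (2 * r).+1) * X r.
  rewrite /al /X /x -!exprM (_ : k * (2 * r) = 2 * k * r)%N; [ring | lia].
have X0 : X 0 = 1.
  rewrite /X /hecke_square_row /theta_row /boxsum big_ord1 big_ord0 addr0 mul1r.
  by rewrite (_ : _ - _ = 0) ?mulr0 //; apply/esym; rewrite -(expr0 q) qXn.
have L : ssum al * (pinf (x * p) p * pinf (- p) p) * (1 - p) = al 0 * pinf p p ^+ 2.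
  apply: (@bailey_limit p p0 (x - 1) (- x) 2 al si ta) => //.
  - by rewrite /si X0 muln0 expr0 mulr1.
  - move=> r; rewrite alE /si /ta !px (_ : 4 * r = r + r + r + r)%N; last by lia.
    by rewrite ?(x2 r.+1) ![x ^+ _.+1]exprS ?exprD ?x2; ring.
  - move=> r; rewrite alE /si /ta !px (_ : 4 * r = r + r + r + r)%N; last by lia.
    by rewrite ?(x2 r.+1) ![x ^+ _.+1]exprS ?exprD ?x2 /p; ring.
  - move=> r.
    have S : hecke_square_row k r.+1 = x ^+ (4 * r).+1 * hecke_square_row k r + 2 * x ^+ (r * r.+1).
      rewrite {1}/hecke_square_row {1}/theta_row boxsumS -/(theta_row _ _ _); congr (_ + _).
        rewrite /hecke_square_row /x -exprM theta_row_shift; last first.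
          by move=> j jr; apply: mulr_ge0 => //; have := square_bound jr; nia.
        by apply: eq_theta_row => j; lia.
      rewrite /x -!exprM !qXn [2 * mono _ _]mulr_natl mulr2n; congr (mono _ _ + mono _ _); lia.
    have C2 m : p ^+ 'C(m.+1, 2) = x ^+ (m * m.+1) by rewrite /p -exprM bin2_double.
    rewrite !C2 /si /ta /X S (_ : r.+1 * r.+2 = r * r.+1 + 2 * r.+1)%N; last by lia.
    by rewrite exprD [(-1) ^+ _.+1]exprS; ring.
  - move=> r; rewrite alE -mulrA; apply: eqm0Ml; apply: eqm0Xk => //; lia.
  apply: cv_ext (cv_mul (cv_pinf (x * p) p0) (cv_pinf (- p) p0)) _ => n.
  rewrite /qpoch -big_split; apply: eq_bigr => i _ /=.
  by rewrite mul2n -addnn exprD !exprS; ring.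
have u1 : 1 + x \is a GRing.unit by apply: unit_coef1; rewrite coef_fpsD x0 addr0.
have a0 : al 0 = 1 + x by rewrite alE X0 mulr1 muln0 expr0 mul1r expr1.
have E : pinf x p = (1 - x) * pinf (x * p) p.
  by rewrite (pinf_split x 1 p0) /qpoch big_ord1 expr0 expr1 mulr1.
have L2 : ssum al * (pinf x p * pinf (- p) p) = pinf p p ^+ 2.
  apply: (mulrI u1); rewrite -a0 -L a0 E (_ : 1 - p = (1 - x) * (1 + x)); last by rewrite /p; ring.
  by ring.
have k20 : (0 < 2 * k)%N by lia.
have pE : p = q ^+ (2 * k) by rewrite /p /x -exprM mulnC.
have O : pinf x p * ell (2 * k) = ell k by rewrite pE pinf_odd.
have Neg : ell (2 * k) * pinf (- p) p = ell (4 * k).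
  rewrite pE (_ : 4 * k = 2 * (2 * k))%N; last by lia.
  exact: pinf_neg.
have I : pinf p p = ell (2 * k) by rewrite pE ellE; reflexivity.
rewrite -O -Neg; move: L2; have <- : hecke_square k = ssum al by [].
rewrite I => L2.
transitivity (hecke_square k * (pinf x p * pinf (- p) p) * ell (2 * k) ^+ 2); first by ring.
by rewrite L2 -exprD.
Qed.

(** * The q-Gauss summation *)

Lemma sum_telescope (F G U : nat -> fps int) A B :
    (forall k, F k * A - G k * B = U k - U k.+1) ->
  forall n, (\sum_(k < n) F k) * A + (\sum_(k < n) G k) * - B = U 0%N - U n.
Proof.
move=> FG; elim=> [|n IH]; first by rewrite !big_ord0 !mul0r addr0 subrr.
rewrite !big_ord_recr /=.
have -> : U 0%N - U n.+1 = (U 0%N - U n) + (U n - U n.+1) by rewrite addrA subrK.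
by rewrite -IH -FG; ring.
Qed.

Section QGauss.

Variable r : nat.
Let z := q ^+ (2 * r).+1.

(** With z = a^2, (z; q^2)_k = (a; q)_k (-a; q)_k, so that these are the terms of the
    2phi1 series with parameters a, -a; zq^i and argument -q^i = zq^i / (-a^2), the
    argument of Gauss's summation theorem. *)
Definition gauss_term i k := qpoch z (q ^+ 2) k * (- q ^+ i) ^+ k
  / (qpoch q q k * qpoch (z * q ^+ i) q k).
Let N i := ssum (gauss_term i).

Lemma coef0_zq i : coef (z * q ^+ i) 0 = 0.
Proof. by rewrite coef_fpsM0 /z coef0q // mul0r. Qed.

Lemma gauss_term_small i k n : (0 < i)%N -> (n <= i * k)%N -> eqm n (gauss_term i k) 0.
Proof.
move=> i0 nk; rewrite /gauss_term; apply: eqm0Ml; apply: eqm0Mr.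
rewrite exprNn; apply: eqm0Mr; rewrite -exprM; exact: eqm0Xk.
Qed.

Lemma gauss_cv i : (0 < i)%N -> cv (fun n => \sum_(k < n) gauss_term i k) (N i).
Proof. by move=> i0; apply: cv_ssum => k; apply: gauss_term_small => //; nia. Qed.

(** Raising i multiplies the series by a rational factor: the difference of the two
    sides telescopes, with U as primitive. As i grows, only the term k = 0 survives,
    which gives the sum as an infinite product. *)
Lemma gauss_contiguous i : (0 < i)%N ->
  N i * ((1 - z * q ^+ i) * (1 + q ^+ i)) = N i.+1 * (1 - z * q ^+ (2 * i)).
Proof.
move=> i0; set c := z * q ^+ i.
have c0 : coef c 0 = 0 by exact: coef0_zq.
have u1 : 1 - c \is a GRing.unit.
  by apply: unit_coef1; rewrite coef_fpsD coef_fpsN c0 oppr0 addr0.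
apply/eqP; rewrite -subr_eq0; apply/eqP.
pose U k := (1 - c) * (gauss_term i k * (1 - q ^+ k)).
have tele k : gauss_term i k * ((1 - c) * (1 + q ^+ i))
    - gauss_term i.+1 k * (1 - z * q ^+ (2 * i)) = U k - U k.+1.
  set a := qpoch z (q ^+ 2) k; set P := qpoch q q k.
  pose w := (P * qpoch c q k.+1)^-1; set Q := q ^+ k; set y := q ^+ i.
  have uP : P \is a GRing.unit by apply: qpoch_unit.
  have uC m : qpoch c q m \is a GRing.unit by apply: qpoch_unit.
  have uk : 1 - c * Q \is a GRing.unit by have := uC k.+1; rewrite qpochS unitrM => /andP[].
  have uq : 1 - q * Q \is a GRing.unit.
    by have := qpoch_unit q k.+1 coefq; rewrite qpochS unitrM => /andP[].
  have e1 : gauss_term i k = a * (- y) ^+ k * ((1 - c * Q) * w).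
    rewrite /gauss_term; congr (_ * _).
    by rewrite /w qpochS mulrA [X in _ = _ * X^-1]mulrC unit_fracK ?unitrM ?uP ?uC.
  have e2 : gauss_term i.+1 k = a * ((- y) ^+ k * Q) * ((1 - c) * w).
    have yq : q ^+ i.+1 = y * q by rewrite exprSr.
    have cq : z * q ^+ i.+1 = c * q by rewrite yq mulrA.
    rewrite /gauss_term cq yq -mulNr exprMn -/Q -/P; congr (_ * _).
    have u' : qpoch (c * q) q k \is a GRing.unit by apply: qpoch_unit; rewrite coef_fpsM0 c0 mul0r.
    by rewrite /w qpochSl mulrCA unit_fracK ?unitrM ?uP ?u' // mulrA.
  have e3 : gauss_term i k.+1 * (1 - q * Q) = a * (1 - z * (Q * Q)) * (- y * (- y) ^+ k) * w.
    have q2k : (q ^+ 2) ^+ k = Q * Q by rewrite -exprM mul2n -addnn exprD.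
    rewrite /gauss_term (qpochS z) (qpochS q) [(- q ^+ i) ^+ k.+1]exprS q2k -/a -/P -/Q -/y.
    rewrite -[LHS]mulrA; congr (_ * _).
    by rewrite -mulrA mulrCA mulrC unit_fracK ?unitrM ?uP ?uC.
  have eU : U k.+1 = (1 - c) * (a * (1 - z * (Q * Q)) * (- y * (- y) ^+ k) * w).
    by rewrite /U -e3 exprS.
  rewrite eU /U e1 e2 mul2n -addnn exprD -/y -/Q /c -/y.
  move: ((- y) ^+ k) => Y; ring.
apply: (cv_uniq (u := fun n => U 0%N - U n)); last first.
  move=> n; rewrite /U expr0 subrr !mulr0 sub0r.
  have -> : - ((1 - c) * (gauss_term i n * (1 - q ^+ n))) =
    gauss_term i n * (- (1 - c) * (1 - q ^+ n)) by ring.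
  by apply: eqm0Ml; apply: gauss_term_small => //; nia.
have i10 : (0 < i.+1)%N by [].
rewrite -[X in cv _ (_ + X)]mulrN.
apply: cv_ext (cv_add (cv_mul (gauss_cv i0) (cv_cst ((1 - c) * (1 + q ^+ i))))
  (cv_mul (gauss_cv i10) (cv_cst (- (1 - z * q ^+ (2 * i)))))) _ => n.
exact: sum_telescope tele n.
Qed.

Lemma gauss_product n : N 1 * (qpoch (z * q) q n * qpoch (- q) q n)
  = qpoch (z * q ^+ 2) (q ^+ 2) n * N n.+1.
Proof.
elim: n => [|n IH]; first by rewrite !qpoch0 !mulr1 mul1r.
rewrite !qpochS.
transitivity (N 1 * (qpoch (z * q) q n * qpoch (- q) q n) *
  ((1 - z * q ^+ n.+1) * (1 + q ^+ n.+1))); first by rewrite exprS; ring.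
rewrite IH -[LHS]mulrA (gauss_contiguous (ltn0Sn n)) (_ : 2 * n.+1 = 2 + 2 * n)%N; last by lia.
by rewrite exprD exprM; ring.
Qed.

Lemma gauss_sum : N 1 * (pinf (z * q) q * pinf (- q) q) = pinf (z * q ^+ 2) (q ^+ 2).
Proof.
have q20 : coef (q ^+ 2) 0 = 0 by rewrite coef0q.
rewrite -[RHS]mulr1.
apply: (cv_uniq (u := fun n => N 1 * (qpoch (z * q) q n * qpoch (- q) q n))).
  by apply: cv_mul; [exact: cv_cst | apply: cv_mul; apply: cv_pinf].
apply: cv_ext (cv_mul (cv_pinf (z * q ^+ 2) q20) (_ : cv (fun n => N n.+1) 1)) _ => n.
  apply: (eqm_trans (g := \sum_(k < n.+1) gauss_term n.+1 k)).
    by apply/eqm_sym; exact: eqmW (@gauss_cv n.+1 (ltn0Sn n) n.+1) (leqnSn n).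
  rewrite big_ord_recl -[X in eqm _ _ X]addr0; apply: eqmD.
    rewrite /gauss_term /= !qpoch0 expr0 mulr1 invr1 mulr1; exact: eqm_refl.
  apply: (eqm_trans (g := \sum_(k < n) (0 : fps int))); last first.
    by rewrite big1_eq; exact: eqm_refl.
  by apply: eqm_sum => k _; apply: gauss_term_small => //; rewrite lift0; nia.
by rewrite gauss_product.
Qed.

End QGauss.

(** * A sum of Hecke type for lambda *)

Definition hecke_lambda_row r := theta_row sg (fun j => (3 * 'C(r, 2) + r)%N%:Z - j * j) r.

Lemma hecke_lambda_rowS r :
  hecke_lambda_row r.+1 = q ^+ (3 * r).+1 * hecke_lambda_row r + 2 * (-1) ^+ r.+1 * q ^+ 'C(r.+1, 2).
Proof.
have B := bin2_double r.
rewrite {1}/hecke_lambda_row {1}/theta_row boxsumS -/(theta_row _ _ _); congr (_ + _).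
  rewrite theta_row_shift; first by apply: eq_theta_row => j; rewrite binS bin1; lia.
  move=> j jr; have := square_bound jr.
  case: r {B} jr => [|r] jr; first by rewrite /= ; lia.
  by have := bin2_double r; nia.
rewrite !qXn /sg /= -mulrA mulr_natl mulr2n -mono_sign.
have -> : 'C(r.+1, 2)%:Z = (3 * 'C(r.+1, 2) + r.+1)%N%:Z - r.+1%:Z * r.+1%:Z by nia.
by congr (mono _ _ + mono _ _); rewrite NegzE mulrNN.
Qed.

(** The sequence alpha_r whose Bailey transform relative to q is 1 / (-q; q)_n. *)
Definition lambda_alpha r := q ^+ r * (1 - q ^+ (2 * r).+1) * hecke_lambda_row r.

Lemma lambda_alpha_small r : eqm r (lambda_alpha r) 0.
Proof. by rewrite /lambda_alpha -mulrA; apply: eqm0Ml; apply: eqm0X. Qed.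

Lemma hecke_lambda_row0 : hecke_lambda_row 0 = 1.
Proof.
rewrite /hecke_lambda_row /theta_row /boxsum big_ord1 big_ord0 addr0 /= -[RHS](expr0 q) qXn.
by congr mono.
Qed.

(** The telescoping recurrence with ratios 1 + q^n and K = 2; the finite product of
    the ratios is (-q; q)_n. *)
Lemma lambda_bailey n : bailey q lambda_alpha n * qpoch (- q) q n = 1.
Proof.
pose si r := (1 + q ^+ r) * hecke_lambda_row r.
pose ta r := (q ^+ (4 * r).+2 + q ^+ (3 * r).+1) * hecke_lambda_row r.
have q2 r : q ^+ (2 * r) = q ^+ r * q ^+ r by rewrite mul2n -addnn exprD.
have r3 r : (3 * r = r + r + r)%N by lia.
have r4 r : (4 * r = r + r + r + r)%N by lia.
have E : bailey q lambda_alpha n * \prod_(i < n) (1 - -1 * q ^+ i.+1 + 0 * q ^+ (2 * i.+1)) = lambda_alpha 0 / (1 - q).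
  apply: (@bailey_den q coefq (-1) 0 2 lambda_alpha si ta) => //.
  - by rewrite /si hecke_lambda_row0 expr0 mulr1.
  - move=> r; rewrite /lambda_alpha /si /ta r4 r3.
    by rewrite ![q ^+ _.+1]exprS ?exprD ?q2; ring.
  - move=> r; rewrite /lambda_alpha /si /ta r4 r3.
    by rewrite ![q ^+ _.+1]exprS ?exprD ?q2; ring.
  - move=> r; rewrite /si /ta hecke_lambda_rowS (binS r.+1) bin1 exprD.
    rewrite (_ : (4 * r).+2 = (3 * r).+1 + r.+1)%N; last by lia.
    by rewrite exprD; ring.
have u1 : 1 - q \is a GRing.unit by have := one_subX_unit coefq 0; rewrite expr1.
have -> : qpoch (- q) q n = \prod_(i < n) (1 - -1 * q ^+ i.+1 + 0 * q ^+ (2 * i.+1)).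
  by apply: eq_bigr => i _; rewrite [q ^+ i.+1]exprS mul0r; ring.
by rewrite E /lambda_alpha hecke_lambda_row0 mulr1 expr0 mul1r muln0 expr1 divrr.
Qed.

Lemma sum_triangle (M : nat) (h : nat -> nat -> fps int) :
  \sum_(n < M) \sum_(r < n.+1) h n r = \sum_(r < M) \sum_(k < M - r) h (r + k)%N r.
Proof.
transitivity (\sum_(n < M) \sum_(r < M) if (r <= n)%N then h n r else 0).
  apply: eq_bigr => n _; rewrite -big_mkcond /= (big_ord_widen_cond M xpredT (h n)) //=.
rewrite exchange_big; apply: eq_bigr => -[r rM] _ /=.
rewrite -(big_mkord xpredT (fun n => if (r <= n)%N then h n r else 0)).
rewrite (@big_cat_nat _ _ _ r) //=; last exact: ltnW.
rewrite big_nat_cond big1 ?add0r; last by move=> n; rewrite andbT /= => nr; rewrite ifF //; lia.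
rewrite -{1}[r]add0n big_addn big_mkord; apply: eq_bigr => k _.
by rewrite addnC leq_addr.
Qed.

Definition hecke_lambda_term r := (-1) ^+ r * (q ^+ (2 * r) * hecke_lambda_row r).

(** D(q) = sum_r (-1)^r q^(3r(r+1)/2) sum_(|j| <= r) (-1)^j q^(-j^2); the rows carry
    the exponent 3r(r-1)/2 + r, and 2r more is added here. *)
Definition hecke_lambda := ssum hecke_lambda_term.
Definition lambda_bailey_term n r := (-1) ^+ n * q ^+ n * qpoch q (q ^+ 2) n *
  (lambda_alpha r / (qpoch q q (n - r) * qpoch q q (n + r).+1)).

Lemma lambda_term_expand n : lambda_term n = \sum_(r < n.+1) lambda_bailey_term n r.
Proof.
rewrite -mulr_sumr /lambda_term; congr (_ * _).
have u : qpoch (- q) q n \is a GRing.unit by apply: qpoch_unit.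
by apply: (mulIr u); rewrite mulVr // lambda_bailey.
Qed.

(** Extracting from the terms with n = r + k all that does not depend on k leaves
    the q-Gauss series with z = q^(2r+1). *)
Lemma lambda_bailey_term_gauss r k : lambda_bailey_term (r + k) r =
  lambda_alpha r * (qpoch q (q ^+ 2) r * (- q) ^+ r / qpoch q q (2 * r).+1 * gauss_term r 1 k).
Proof.
rewrite /lambda_bailey_term /gauss_term addKn expr1.
rewrite (_ : (r + k + r).+1 = (2 * r).+1 + k)%N; last by lia.
rewrite !qpochD -exprM -exprS [q * q ^+ _]mulrC.
have uP := qpoch_unit q (2 * r).+1 coefq; have uk := qpoch_unit q k coefq.
have uC : qpoch (q ^+ (2 * r).+1 * q) q k \is a GRing.unit.
  by apply: qpoch_unit; rewrite coef_fpsM0 coefq mulr0.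
set P := qpoch q q (2 * r).+1 in uP *; set Pk := qpoch q q k in uk *.
set C := qpoch (_ * q) q k in uC *.
rewrite (_ : Pk * (P * C) = P * (Pk * C)); last by ring.
rewrite [(P * _)^-1]invrM ?unitrM ?uk // ![(- q) ^+ _]exprNn !exprD.
by move: (P^-1) ((Pk * C)^-1) => P' C'; ring.
Qed.

(** Expand 1 / (-q; q)_n by [lambda_bailey], exchange the two sums, and apply
    [gauss_sum] to the inner one. *)
Lemma lambda_hecke : mock_lambda * (ell 1 * pinf (- q) q) = hecke_lambda * pinf q (q ^+ 2).
Proof.
pose A r := qpoch q (q ^+ 2) r * (- q) ^+ r / qpoch q q (2 * r).+1.
pose N r := ssum (gauss_term r 1).
have lsmall n : eqm n (lambda_term n) 0.
  rewrite /lambda_term -!mulrA; apply: eqm0Mr; apply: eqm0Ml; exact: eqm0X.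
have cl : cv (fun n => \sum_(r < n) lambda_term r) mock_lambda.
  move=> n m mn; rewrite (coef_fsum _ lsmall) coef_bigsum.
  by apply: (sum_stable (c := fun i => coef (lambda_term i) m)) => // i; apply: lsmall.
have sm r : eqm r (lambda_alpha r * (A r * N r)) 0 by apply/eqm0Ml/lambda_alpha_small.
have lE : mock_lambda = ssum (fun r => lambda_alpha r * (A r * N r)).
  apply: (cv_uniq _ (cv_ssum sm)); apply: cv_eqm cl _ => M.
  have -> : \sum_(n < M) lambda_term n =
      \sum_(r < M) lambda_alpha r * (A r * \sum_(k < M - r) gauss_term r 1 k).
    rewrite (eq_bigr (fun n : 'I_M => \sum_(r < n.+1) lambda_bailey_term n r)); last first.
      by move=> n _; exact: lambda_term_expand.
    rewrite sum_triangle; apply: eq_bigr => r _; rewrite 2!mulr_sumr.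
    by apply: eq_bigr => k _; rewrite lambda_bailey_term_gauss.
  apply: eqm_sum => -[r rM] _ /=; apply: (@eqm_mull r); [exact: ltnW | exact: lambda_alpha_small |].
  apply: eqmM; first exact: eqm_refl.
  exact: (@gauss_cv r 1 isT).
rewrite lE ssumMr // /hecke_lambda ssumMr; last first.
  by move=> r; rewrite /hecke_lambda_term; apply: eqm0Mr; apply: eqm0Ml; apply: eqm0Xk => //; lia.
congr ssum; apply/funext => r.
have G : N r * (pinf (q ^+ (2 * r).+1 * q) q * pinf (- q) q) = _ := gauss_sum r.
have -> : ell 1 = qpoch q q (2 * r).+1 * pinf (q ^+ (2 * r).+1 * q) q.
  by rewrite -ellE expr1 (pinf_split q (2 * r).+1 coefq) [q * _]mulrC.
have -> : pinf q (q ^+ 2) = qpoch q (q ^+ 2) r * (1 - q ^+ (2 * r).+1) *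
    pinf (q ^+ (2 * r).+1 * q ^+ 2) (q ^+ 2).
  rewrite (pinf_split q r.+1 (coef0q (isT : (0 < 2)%N))) qpochS -exprM -exprS.
  by rewrite -exprM -exprS -exprD; congr (_ * pinf (q ^+ _) _); lia.
rewrite -G /A; have uP := qpoch_unit q (2 * r).+1 coefq.
set P := qpoch q q _ in uP *; rewrite /lambda_alpha /hecke_lambda_term [(- q) ^+ r]exprNn.
rewrite (_ : q ^+ (2 * r) = q ^+ r * q ^+ r); last by rewrite mul2n -addnn exprD.
transitivity (q ^+ r * (1 - q ^+ (2 * r).+1) * hecke_lambda_row r * (qpoch q (q ^+ 2) r *
   ((-1) ^+ r * q ^+ r) * N r) * (pinf (q ^+ (2 * r).+1 * q) q * pinf (- q) q) * (P^-1 * P)).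
  by move: (P^-1) => P'; ring.
by rewrite mulVr //; ring.
Qed.

(** * Hecke-type sums as sums over a plane lattice *)

(** For m >= 0 this is the indicator of |j| <= 2m, and for m < 0 it is minus the
    indicator of |j| <= -2m - 1 ([chi_ge0], [chi_lt0]). As a difference of two
    half-planes it changes only on a few lines under m -> m + 1 ([chi_diff]). *)
Definition chi (m j : int) : int :=
  (if j <= 2 * m then 1 else 0) - (if j < - (2 * m) then 1 else 0).

Lemma chi_ge0 (n : nat) j : chi n%:Z j = if (`|j| <= 2 * n)%N then 1 else 0.
Proof. by rewrite /chi; case: ifP; case: ifP; case: ifP; lia. Qed.
Lemma chi_lt0 (n : nat) j : chi (Negz n) j = if (`|j| <= (2 * n).+1)%N then -1 else 0.
Proof. by rewrite /chi NegzE; case: ifP; case: ifP; case: ifP; lia. Qed.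

Lemma coef_theta_row w e r n : coef (theta_row w e r) n =
  zsum (fun j => if (`|j| <= r)%N && (e j == n%:Z) then w j else 0).
Proof.
rewrite (@zsum_box r); last by move=> j; case: (leqP `|j|%N r).
rewrite /theta_row /boxsum coef_fpsD !coef_bigsum.
by congr (_ + _); apply: eq_bigr => j _; rewrite coef_mono /= ?ltn_ord //= -ltnS ltn_ord.
Qed.

Lemma coef_hecke_lambda_term r n : coef (hecke_lambda_term r) n = (-1) ^+ r *
  zsum (fun j => if (`|j| <= r)%N && ((3 * 'C(r, 2) + 3 * r)%N%:Z - j * j == n%:Z) then sg j else 0).
Proof.
rewrite /hecke_lambda_term coef_signM /hecke_lambda_row theta_row_shift.
  by rewrite coef_theta_row; congr (_ * _); apply: eq_zsum => j; congr (if _ && (_ == _) then _ else _); lia.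
move=> j jr; have := square_bound jr.
case: r jr => [|r] jr; first by rewrite /= ; lia.
by have := bin2_double r; nia.
Qed.

(** The coefficient of q^z in D. Rows r = 2m and r = -2m - 1 are merged:
    3r(r+1)/2 is 6m^2 + 3m in both cases, and the sign (-1)^r is that of chi. *)
Definition hecke_lambda_sum (z : int) := zsum (fun m => zsum (fun j =>
  if 6 * m * m + 3 * m - j * j == z then chi m j * sg j else 0)).

Lemma chi_nz m j : chi m j != 0 ->
  (0 <= m /\ j * j <= 4 * m * m) \/ (m <= -1 /\ j * j <= (2 * m + 1) * (2 * m + 1)).
Proof.
case: m => n; [rewrite chi_ge0 | rewrite chi_lt0]; case: leqP => // jn _; [left | right].
  by split=> //; have := square_bound jn; nia.
by split; [lia | have := square_bound jn; rewrite NegzE; nia].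
Qed.

Lemma hecke_lambda_exponent_bound m j : chi m j != 0 -> `|m| <= 6 * m * m + 3 * m - j * j.
Proof. by move=> /chi_nz[[m0 jm]|[m0 jm]]; nia. Qed.

Lemma coefz_hecke_lambda z : coefz hecke_lambda z = hecke_lambda_sum z.
Proof.
case: z => n; last first.
  apply/esym/zsum0 => m; apply: zsum0 => j; case: eqP => // E.
  apply/eqP; rewrite mulf_eq0; apply/orP; left.
  by apply: contraT => /hecke_lambda_exponent_bound; rewrite E; lia.
rewrite /coefz /hecke_lambda coef_ssum /hecke_lambda_sum (@zsum_pairs n.+1); last first.
  move=> m /zsum_nz[j]; case: (_ =P n%:Z) => [E|_]; last by rewrite eqxx.
  by rewrite mulf_eq0 negb_or => /andP[/hecke_lambda_exponent_bound]; rewrite E; lia.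
rewrite -(@sum_stable (fun r => coef (hecke_lambda_term r) n) n (2 * n.+1)%N); last 2 first.
- lia.
- move=> r nr; rewrite coef_hecke_lambda_term; apply/eqP; rewrite mulf_eq0; apply/orP; right; apply/eqP.
  apply: zsum0 => j; case: leqP => //= jr; case: eqP => // E; have := square_bound jr.
  by case: r nr jr E => // r nr jr E; have := bin2_double r; nia.
rewrite (sum_even_odd (fun r => coef (hecke_lambda_term r) n)); apply: eq_bigr => -[r rn] _; rewrite [nat_of_ord _]/= !coef_hecke_lambda_term -!zsumM.
congr (_ + _); apply: eq_zsum => j; rewrite ?chi_ge0 ?chi_lt0.
  rewrite exprM sqrrN !expr1n mul1r.
  have -> : (3 * 'C(2 * r, 2) + 3 * (2 * r) = 6 * r * r + 3 * r)%N.
    case: r {rn} => // r; rewrite (_ : 2 * r.+1 = (2 * r).+2)%N; last by lia.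
    by have := bin2_double (2 * r).+1; lia.
  have -> : (6 * r * r + 3 * r)%N%:Z - j * j = 6 * r%:Z * r%:Z + 3 * r%:Z - j * j by lia.
  by case: leqP => _; case: eqP => _ /=; rewrite ?mul1r ?mul0r.
rewrite exprS exprM sqrrN !expr1n mulr1.
have -> : (3 * 'C((2 * r).+1, 2) + 3 * (2 * r).+1 = 6 * r * r + 9 * r + 3)%N.
  by have := bin2_double (2 * r); lia.
have -> : (6 * r * r + 9 * r + 3)%N%:Z - j * j = 6 * Negz r * Negz r + 3 * Negz r - j * j.
  by rewrite NegzE; lia.
by case: leqP => _; case: eqP => _ /=; rewrite ?mulN1r ?mul0r ?mulr0.
Qed.

Lemma coef_hecke_square_term k r n : coef ((-1) ^+ r *
    (q ^+ (2 * k * r) * (1 + q ^+ (k * (2 * r).+1)) * hecke_square_row k r)) n = (-1) ^+ r *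
  (zsum (fun j => if (`|j| <= r)%N && (k%:Z * (2 * r%:Z * r%:Z + r%:Z - j * j) == n%:Z) then 1 else 0) +
   zsum (fun j => if (`|j| <= r)%N && (k%:Z * (2 * r%:Z * r%:Z + 3 * r%:Z + 1 - j * j) == n%:Z) then 1 else 0)).
Proof.
have e0 j : (`|j| <= r)%N -> 0 <= k%:Z * (2 * r%:Z ^+ 2 - r%:Z - j * j).
  by move=> jr; apply: mulr_ge0 => //; have := square_bound jr; nia.
rewrite coef_signM [q ^+ _ * _]mulrDr mulr1 mulrDl -exprD coef_fpsD /hecke_square_row !theta_row_shift // !coef_theta_row.
by congr (_ * (_ + _)); apply: eq_zsum => j; congr (if _ && (_ == _) then _ else _); lia.
Qed.

(** Rows r = m and r = -m - 1 merged: they carry the two parts Q^(2r^2 + r) and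
    Q^(2r^2 + r + 2r + 1) of the r-th term. *)
Definition hecke_square_sum (k : nat) (z : int) := zsum (fun m => zsum (fun i =>
  if k%:Z * (2 * m * m + m - i * i) == z then sg m * chi m (2 * i) else 0)).

Lemma hecke_square_exponent_bound m i : chi m (2 * i) != 0 -> `|m| <= 2 * m * m + m - i * i.
Proof. by move=> /chi_nz[[m0 jm]|[m0 jm]]; nia. Qed.

Lemma coefz_hecke_square k z : (0 < k)%N -> coefz (hecke_square k) z = hecke_square_sum k z.
Proof.
move=> k0; case: z => n; last first.
  apply/esym/zsum0 => m; apply: zsum0 => j; case: eqP => // E.
  apply/eqP; rewrite mulf_eq0; apply/orP; right.
  by apply: contraT => /hecke_square_exponent_bound; nia.
rewrite /coefz /hecke_square coef_ssum /hecke_square_sum (@zsum_pairs n.+1); last first.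
  move=> m /zsum_nz[j]; case: (_ =P n%:Z) => [E|_]; last by rewrite eqxx.
  by rewrite mulf_eq0 negb_or => /andP[_ /hecke_square_exponent_bound]; nia.
apply: eq_bigr => -[r rn] _; rewrite [nat_of_ord _]/= coef_hecke_square_term mulrDr -!zsumM.
congr (_ + _); apply: eq_zsum => j; rewrite ?chi_ge0 ?chi_lt0.
  have -> : (`|(2 * j)%R| <= 2 * r)%N = (`|j| <= r)%N by lia.
  by case: leqP => _; case: eqP => _ /=; rewrite ?mulr1 ?mulr0.
have -> : (`|(2 * j)%R| <= (2 * r).+1)%N = (`|j| <= r)%N by lia.
rewrite sgNegz (_ : 2 * Negz r * Negz r + Negz r - j * j = 2 * r%:Z * r%:Z + 3 * r%:Z + 1 - j * j); last first.
  by rewrite NegzE; lia.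
by case: leqP => _; case: eqP => _ /=; rewrite ?mulr1 ?mulr0 ?mulrN1 ?opprK.
Qed.

Lemma coef_hecke_pronic_term k r n : coef ((-1) ^+ r * (q ^+ (2 * k * r) * hecke_pronic_row k r)) n = (-1) ^+ r *
  zsum (fun j => if (`|j| <= r)%N && (k%:Z * (2 * r%:Z * r%:Z + 2 * r%:Z - j * (j + 1)) == n%:Z) then 1 else 0).
Proof.
have e0 j : (`|j| <= r)%N -> 0 <= k%:Z * (2 * r%:Z ^+ 2 - j * (j + 1)).
  by move=> jr; apply: mulr_ge0 => //; have := pronic_bound jr; nia.
rewrite coef_signM /hecke_pronic_row !theta_row_shift // !coef_theta_row.
by congr (_ * _); apply: eq_zsum => j; congr (if _ && (_ == _) then _ else _); lia.
Qed.

(** Rows r = m and r = -m - 1 merged. The exponent has the same value in both, so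
    each term of the Hecke-type sum occurs twice. *)
Definition hecke_pronic_sum (k : nat) (z : int) := zsum (fun m => zsum (fun i =>
  if k%:Z * (2 * m * m + 2 * m - i * (i + 1)) == z then sg m * chi m (2 * i + 1) else 0)).

Lemma hecke_pronic_exponent_bound m i : chi m (2 * i + 1) != 0 -> `|m| <= 2 * m * m + 2 * m - i * (i + 1) + 1.
Proof. by move=> /chi_nz[[m0 jm]|[m0 jm]]; nia. Qed.

(** The ranges of i in the two merged rows are [-r, r-1] and [-r-1, r]. They exceed
    twice |i| <= r by i = -r-1 and fall short of it by i = r; a function of i(i+1) has
    the same value at both. *)
Lemma zsum_window (g : int -> int) (r : nat) : g r%:Z = g (- r%:Z - 1) ->
  zsum (fun i => if (- r%:Z <= i) && (i < r%:Z) then g i else 0) +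
  zsum (fun i => if (- r%:Z - 1 <= i) && (i <= r%:Z) then g i else 0) =
  2 * zsum (fun i => if (`|i| <= r)%N then g i else 0).
Proof.
move=> gr; apply: (@addIr _ (g r%:Z)); rewrite [in RHS]gr.
rewrite -(zsum_delta r%:Z g) -(zsum_delta (- r%:Z - 1) g) -zsumM.
have B (P : pred int) (h : int -> int) : (forall i, P i -> (`|i| <= r.+1)%N) ->
  bounded (fun i => if P i then h i else 0) by exact: bounded_range.
rewrite -zsumD; [|apply: B; lia|apply: B; lia].
rewrite -zsumD; first last.
- by apply: B => i; lia.
- exists r.+1 => i; case: ifP; case: ifP; lia.
rewrite -zsumD; first last.
- by apply: B => i; lia.
- exists r.+1 => i; case: ifP; rewrite ?mulr0 //; lia.
apply: eq_zsum => i.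
by case: ifP => ?; case: ifP => ?; case: ifP => ?; case: ifP => ?; case: ifP => ?; lia.
Qed.

Lemma coefz_hecke_pronic k z : (0 < k)%N -> hecke_pronic_sum k z = 2 * coefz (hecke_pronic k) z.
Proof.
move=> k0; case: z => n; last first.
  rewrite mulr0; apply: zsum0 => m; apply: zsum0 => j; case: eqP => // E.
  apply/eqP; rewrite mulf_eq0; apply/orP; right; apply: contraT => c.
  have := hecke_pronic_exponent_bound c; have m0 : m != 0.
    by apply: contraTneq c => ->; rewrite (chi_ge0 0) ifF //; lia.
  nia.
rewrite /coefz /hecke_pronic coef_ssum /hecke_pronic_sum (@zsum_pairs n.+2); last first.
  move=> m /zsum_nz[j]; case: (_ =P n%:Z) => [E|_]; last by rewrite eqxx.
  by rewrite mulf_eq0 negb_or => /andP[_ /hecke_pronic_exponent_bound]; nia.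
rewrite -(@sum_stable (fun r => coef ((-1) ^+ r * (q ^+ (2 * k * r) * hecke_pronic_row k r)) n) n n.+2) //; last first.
  move=> r nr; rewrite coef_hecke_pronic_term; apply/eqP; rewrite mulf_eq0; apply/orP; right; apply/eqP.
  by apply: zsum0 => j; case: leqP => //= jr; case: eqP => // E; have := pronic_bound jr; nia.
rewrite mulr_sumr; apply: eq_bigr => -[r rn] _; rewrite [nat_of_ord _]/= coef_hecke_pronic_term mulrCA.
pose g (j : int) : int := if k%:Z * (2 * r%:Z * r%:Z + 2 * r%:Z - j * (j + 1)) == n%:Z then 1 else 0.
have -> : zsum (fun j => if (`|j| <= r)%N && (k%:Z * (2 * r%:Z * r%:Z + 2 * r%:Z - j * (j + 1)) == n%:Z)
    then 1 else 0) = zsum (fun i => if (`|i| <= r)%N then g i else 0).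
  by apply: eq_zsum => i; rewrite /g; case: leqP.
rewrite -zsum_window; last by rewrite /g; congr (if _ == _ then _ else _); lia.
rewrite mulrDr -!zsumM; congr (_ + _); apply: eq_zsum => i; rewrite ?chi_ge0 ?chi_lt0 /g.
  rewrite sgPosz; have -> : (`|(2 * i + 1)%R| <= 2 * r)%N = (- r%:Z <= i) && (i < r%:Z) by lia.
  by case: andP => _; case: eqP => _ /=; rewrite ?mulr1 ?mulr0.
rewrite sgNegz.
have -> : (`|(2 * i + 1)%R| <= (2 * r).+1)%N = (- r%:Z - 1 <= i) && (i <= r%:Z) by lia.
rewrite (_ : 2 * Negz r * Negz r + 2 * Negz r = 2 * r%:Z * r%:Z + 2 * r%:Z); last by rewrite NegzE; lia.
by case: andP => _; case: eqP => _ /=; rewrite ?mulr1 ?mulr0 ?mulrN1 ?opprK.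
Qed.

(** * Slicing the triple sum *)

Definition slice_term (c k z m j : int) : int :=
  if 8 * m * m + 4 * m - 4 * c * m - j * j == z then sg m * chi (m + k) j else 0.

(** One plane m - t = n of the triple sum, n = 4k + c, after the translation by k
    that centres the quadratic form; the constant term of the form is absorbed in z,
    and j has the parity of c because the total exponent is even. *)
Definition slice (c k z : int) := zsum (fun m => zsum (fun i => slice_term c k z m (2 * i + c))).

Lemma chi_abs m j : chi m j != 0 -> `|j| <= 2 * `|m| + 1.
Proof. by case: m => n; [rewrite chi_ge0 | rewrite chi_lt0]; case: leqP => // ? _; lia. Qed.

(** The exponent is indefinite, but on the support of chi it grows
    quadratically in m, so each coefficient is a finite sum. *)
Lemma slice_term_nz c k z m j : slice_term c k z m j != 0 ->
  `|m| <= `|z| + (2 * `|k| + 1) * (2 * `|k| + 1) + 2 + `|c| + 2 * `|k| /\ `|j| <= 2 * `|m + k| + 1.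
Proof.
rewrite /slice_term; case: (_ =P z) => [E|_]; last by rewrite eqxx.
rewrite mulf_eq0 negb_or => /andP[_ /chi_abs jb]; split=> //.
set L := (2 * `|k| + 1) * _; set X := `|m|; set K := 2 + `|c| + 2 * `|k|.
have jj : j * j <= (2 * X + 2 * `|k| + 1) * (2 * X + 2 * `|k| + 1).
  have j1 : `|j| <= 2 * X + 2 * `|k| + 1 by rewrite /X; lia.
  have -> : j * j = `|j| * `|j| by lia.
  by apply: ler_pM => //; lia.
have E1 : 8 * (X * X) - 4 * X - 4 * (`|c| * X) - j * j <= z.
  have -> : X * X = m * m by rewrite /X; lia.
  have : c * m <= `|c| * X by rewrite /X -normrM ler_norm.
  by rewrite -E /X; lia.
have [|big] := leP X (`|z| + L + K); first by rewrite /K; lia.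
have : (L + `|z| + 1) * 1 <= (X - K) * X.
  by apply: ler_pM; rewrite /L /K in big *; lia.
rewrite /L /K in big *; nia.
Qed.

Lemma bounded_inner c k z m : bounded (fun i => slice_term c k z m (2 * i + c)).
Proof.
exists (`|c| + `|m| + `|k| + 1)%N => i /slice_term_nz[_]; lia.
Qed.

Lemma bounded_outer c k z : bounded (fun m => zsum (fun i => slice_term c k z m (2 * i + c))).
Proof.
exists (`|(`|z| + (2 * `|k| + 1) * (2 * `|k| + 1) + 2 + `|c| + 2 * `|k|)%R|)%N => m.
by move=> /zsum_nz[i /slice_term_nz[+ _]]; lia.
Qed.

Lemma chi_diff M j : chi (M + 1) j + -1 * chi M j =
  (if j == 2 * M + 1 then 1 else 0) + (if j == 2 * M + 2 then 1 else 0) +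
  ((if j == - 2 * M - 1 then 1 else 0) + (if j == - 2 * M - 2 then 1 else 0)).
Proof.
rewrite /chi; case: ifP => ?; case: ifP => ?; case: ifP => ?; case: ifP => ?;
case: ifP => ?; case: ifP => ?; case: ifP => ?; case: ifP => ?; lia.
Qed.

(** The difference of the two sides is a sum over the lines on which chi (m + k, j)
    jumps. On those with j of the parity of c the exponent is a quadratic polynomial
    in m with a half-integral axis of symmetry: reflecting m in it preserves the
    exponent and reverses the sign (-1)^m. *)
Lemma slice_step c k z : slice c (k + 1) z = slice c k z.
Proof.
suff : slice c (k + 1) z + -1 * slice c k z = 0 by lia.
rewrite /slice -zsumM -zsumD; [|exact: bounded_outer|exact/bounded_mul/bounded_outer].
have [e u12] : exists e, c + 2 * e = 1 \/ c + 2 * e = 2.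
  by exists (- ((c - 1) %/ 2)%Z); lia.
pose w m : int := 8 * m * m + 4 * m - 4 * c * m.
pose G m : int := if w m - (2 * (m + k + e) + c) * (2 * (m + k + e) + c) == z then sg m * 2 else 0.
rewrite (@eq_zsum _ G).
  apply: (@zsum_anti (fun m => 2 * (c + k + e) - 1 - m)) => m; first lia.
  rewrite /G (_ : sg (2 * (c + k + e) - 1 - m) = - sg m); last first.
    by rewrite sgD sgN (_ : _ - 1 = 2 * (c + k + e - 1) + 1) ?sg_odd ?mulN1r //; lia.
  rewrite mulNr -(fun_if -%R _ _ 0) ?oppr0; congr (- (if _ then _ else _)).
  by apply/eqP/eqP => <-; rewrite /w; lia.
move=> m; rewrite -zsumM -zsumD; [|exact: bounded_inner|exact/bounded_mul/bounded_inner].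
pose g (i : int) : int := if w m - (2 * i + c) * (2 * i + c) == z then sg m else 0.
rewrite (@eq_zsum _ (fun i => (if i == m + k + e then g i else 0) +
                              (if i == - (m + k + e + c) then g i else 0))).
  rewrite zsumD; last 2 first.
  - by exists `|(m + k + e)%R|%N => i; case: (i =P _) => [->|_]; rewrite ?eqxx.
  - by exists `|(m + k + e + c)%R|%N => i; case: (i =P _) => [->|_]; rewrite ?eqxx // abszN.
  rewrite !zsum_delta /g /G.
  rewrite (_ : 2 * - (m + k + e + c) + c = - (2 * (m + k + e) + c)) ?mulrNN; last by lia.
  by case: ifP => _; rewrite ?addr0 //; lia.
move=> i; rewrite /slice_term /g -/(w m) addrA; case: ifP => _; last first.
  by rewrite !if_same mulr0 addr0.
rewrite mulrCA -mulrDr chi_diff.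
have -> : (if i == m + k + e then sg m else 0) + (if i == - (m + k + e + c) then sg m else 0) =
   sg m * ((if i == m + k + e then 1 else 0) + (if i == - (m + k + e + c) then 1 else 0)).
  by rewrite mulrDr; congr (_ + _); case: ifP; rewrite ?mulr1 ?mulr0.
congr (_ * _).
case: u12 => u12; case: (i =P m + k + e) => ?; case: (i =P - _) => ?;
  case: ifP => ?; case: ifP => ?; case: ifP => ?; case: ifP => ?; lia.
Qed.

Lemma slice_const c k z : slice c k z = slice c 0 z.
Proof.
case: k => n.
  elim: n => [//|n IH]; rewrite (_ : Posz n.+1 = n%:Z + 1); last by lia.
  by rewrite slice_step IH.
elim: n => [|n IH]; first by have := slice_step c (-1) z => <-.
by rewrite -IH (_ : Negz n = Negz n.+1 + 1) ?slice_step //; lia.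
Qed.

(** For c = 1 the exponent is 8m^2 - j^2, which is even in m, whereas chi (m, j) is odd
    in m for odd j. *)
Lemma slice1 z : slice 1 0 z = 0.
Proof.
apply: (@zsum_anti (fun m => - m)) => m; first lia.
rewrite -[RHS]mulN1r -zsumM; apply: eq_zsum => i.
rewrite /slice_term !addr0 sgN.
have -> : chi (- m) (2 * i + 1) = - chi m (2 * i + 1).
  by rewrite /chi; case: ifP => ?; case: ifP => ?; case: ifP => ?; case: ifP => ?; lia.
rewrite (_ : 8 * - m * - m + 4 * - m - 4 * 1 * - m = 8 * m * m + 4 * m - 4 * 1 * m); last by lia.
by case: ifP => _; rewrite ?mulr0 // mulrN mulN1r.
Qed.

Lemma slice0 z : slice 0 0 (2 * z) = hecke_square_sum 2 z.
Proof.
apply: eq_zsum => m; apply: eq_zsum => i; rewrite /slice_term !addr0.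
by congr (if _ then _ else _); apply/eqP/eqP; lia.
Qed.

Lemma sliceN1 z : slice (-1) 0 (2 * z - 1) = hecke_pronic_sum 2 z.
Proof.
apply: eq_zsum => m.
have hK : cancel (fun i : int => i + 1) (fun i => i - 1) by move=> i; lia.
have gK : cancel (fun i : int => i - 1) (fun i => i + 1) by move=> i; lia.
rewrite (zsum_reindex _ hK gK); apply: eq_zsum => i; rewrite /slice_term addr0.
rewrite (_ : 2 * (i + 1) + -1 = 2 * i + 1); last by lia.
by congr (if _ then _ else _); apply/eqP/eqP; lia.
Qed.

(** The terms of psi(-q) D(q) that contribute to the coefficient of q^N. *)
Definition triple (N t m j : int) : int :=
  if 6 * m * m + 3 * m - j * j + (2 * t * t + t) == N then sg t * (chi m j * sg j) else 0.

Lemma triple_nz N t m j : triple N t m j != 0 -> `|t| <= N /\ `|m| <= N /\ `|j| <= 2 * N + 1.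
Proof.
rewrite /triple; case: (_ =P N) => [E|_]; last by rewrite eqxx.
rewrite !mulf_eq0 !negb_or => /andP[_ /andP[cn _]].
have := hecke_lambda_exponent_bound cn; have := chi_abs cn.
have : `|t| <= 2 * t * t + t by nia.
lia.
Qed.

(** The form 6m^2 + 3m - j^2 + 2t^2 + t with t = m - 4k - c, translated by m -> m + k,
    is 8m^2 + 4m - 4cm - j^2 plus a constant: 4 is the step in n that makes an integral
    translation possible. *)
Lemma triple_slice (N k m i c : int) : triple (2 * N) (m + k - (4 * k + c)) (m + k) (2 * i + c) =
  sg k * slice_term c k (2 * N - (24 * k * k + 12 * c * k + 2 * c * c - c)) m (2 * i + c).
Proof.
rewrite /triple /slice_term.
have -> : sg (m + k - (4 * k + c)) = sg m * sg k * sg c.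
  rewrite -!sgD (_ : m + k - _ = m + k + c + 2 * (- 2 * k - c)); last by lia.
  by rewrite sgD sg_even mulr1.
rewrite (sgD (2 * i)) sg_even mul1r.
have sc : sg c * sg c = 1 by rewrite -sgD (_ : c + c = 2 * c) ?sg_even //; lia.
have -> : sg m * sg k * sg c * (chi (m + k) (2 * i + c) * sg c) =
    sg k * (sg m * chi (m + k) (2 * i + c)) * (sg c * sg c) by ring.
rewrite sc mulr1; set w := sg m * _; set j := 2 * i + c.
have -> : (6 * (m + k) * (m + k) + 3 * (m + k) - j * j + (2 * (m + k - (4 * k + c)) * (m + k - (4 * k + c)) + (m + k - (4 * k + c))) == 2 * N)
   = (8 * m * m + 4 * m - 4 * c * m - j * j == 2 * N - (24 * k * k + 12 * c * k + 2 * c * c - c)).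
  by apply/eqP/eqP; lia.
by case: ifP; rewrite ?mulr0.
Qed.

Section Slicing.

Variable N : nat.
Let H t m := zsum (triple (2 * N%:Z) t m).
Let f n := zsum (fun m => H (m - n) m).

Lemma triple_line_nz t m : H t m != 0 -> (`|t| <= 2 * N)%N /\ (`|m| <= 2 * N)%N.
Proof. by move=> /zsum_nz[j /triple_nz[]]; lia. Qed.
Lemma slices_bounded : bounded f.
Proof. by exists (4 * N)%N => n /zsum_nz[m /triple_line_nz[]]; lia. Qed.

Lemma slice_of_plane k c :
  f (4 * k + c) = sg k * slice c 0 (2 * N%:Z - (24 * k * k + 12 * c * k + 2 * c * c - c)).
Proof.
rewrite -(slice_const c k) /f.
have hK : cancel (fun m : int => m + k) (fun m => m - k) by move=> m; lia.
have gK : cancel (fun m : int => m - k) (fun m => m + k) by move=> m; lia.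
rewrite (zsum_reindex _ hK gK) /slice -zsumM; apply: eq_zsum => m.
rewrite -zsumM /H (@zsum_inj (fun i => 2 * i + c)); first last.
- move=> j; rewrite /triple; case: (_ =P 2 * N%:Z) => [E|_]; last by rewrite eqxx.
  move=> _; have [s js] : exists s, j * j = j + 2 * s.
    have [d [->|->]] : exists d, j = 2 * d \/ j = 2 * d + 1 by exists (j %/ 2)%Z; lia.
      by exists (2 * d * d - d); lia.
    by exists (2 * d * d + d); lia.
  by exists ((j - c) %/ 2)%Z; lia.
- by move=> x y; lia.
by apply: eq_zsum => i; exact: triple_slice.
Qed.

Lemma triple_slices : zsum (fun t => sg t * hecke_lambda_sum (2 * N%:Z - (2 * t * t + t))) = zsum f.
Proof.
transitivity (zsum (fun t => zsum (H t))).
  apply: eq_zsum => t; rewrite -zsumM; apply: eq_zsum => m; rewrite -zsumM; apply: eq_zsum => j.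
  rewrite /triple (_ : (_ == 2 * N%:Z) = (6 * m * m + 3 * m - j * j == 2 * N%:Z - (2 * t * t + t))).
    by case: ifP; rewrite ?mulr0.
  by apply/eqP/eqP; lia.
rewrite (@zsum_exchange (2 * N)); last by move=> t m; exact: triple_line_nz.
transitivity (zsum (fun m => zsum (fun n => H (m - n) m))).
  apply: eq_zsum => m.
  have mK : cancel (fun n : int => m - n) (fun n => m - n) by move=> n; lia.
  by rewrite (zsum_reindex _ mK mK).
by rewrite (@zsum_exchange (4 * N)) // => m n /triple_line_nz; lia.
Qed.

(** The planes m - t = n are sorted by n modulo 4. Those with n = 4k + 1 vanish, those
    with n = 4k + 2 cancel under k -> -1 - k, and those with n = 4k and n = -4k - 1
    give the two sums. *)
Lemma slicing : zsum (fun t => sg t * hecke_lambda_sum (2 * N%:Z - (2 * t * t + t))) =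
  zsum (fun k => sg k * hecke_square_sum 2 (N%:Z - 12 * (k * k))) +
  zsum (fun k => sg k * hecke_pronic_sum 2 (N%:Z - 1 - 6 * (2 * k * k + k))).
Proof.
have sub2 (F : int -> int) : bounded F -> bounded (fun i => F (2 * i)).
  by move=> [B sF]; exists B => i /sF; lia.
have sub21 (F : int -> int) : bounded F -> bounded (fun i => F (2 * i + 1)).
  by move=> [B sF]; exists B => i /sF; lia.
rewrite triple_slices (zsum_parity slices_bounded).
rewrite (zsum_parity (sub2 _ slices_bounded)) (zsum_parity (sub21 _ slices_bounded)).
have -> : zsum (fun i => f (2 * (2 * i))) = zsum (fun k => sg k * hecke_square_sum 2 (N%:Z - 12 * (k * k))).
  apply: eq_zsum => k; rewrite (_ : 2 * (2 * k) = 4 * k + 0) ?slice_of_plane; last by lia.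
  by rewrite -slice0; congr (_ * slice _ _ _); lia.
have -> : zsum (fun i => f (2 * (2 * i + 1))) = 0.
  apply: (@zsum_anti (fun k => - 1 - k)) => k; first lia.
  have e x : 2 * (2 * x + 1) = 4 * x + 2 :> int by lia.
  rewrite !e !slice_of_plane.
  rewrite (_ : sg (-1 - k) = - sg k); last first.
    rewrite (_ : sg (-1 - k) = sg (k + (2 * (-1 - k) + 1))); last by congr sg; lia.
    by rewrite sgD sg_odd mulrN1.
  by rewrite mulNr; congr (- (_ * slice _ _ _)); lia.
have -> : zsum (fun i => f (2 * (2 * i) + 1)) = 0.
  by apply: zsum0 => k; rewrite (_ : 2 * (2 * k) + 1 = 4 * k + 1) ?slice_of_plane ?slice1 ?mulr0 //; lia.
rewrite addr0 add0r; congr (_ + _).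
have hK : cancel (fun k : int => - 1 - k) (fun k => - 1 - k) by move=> k; lia.
rewrite (zsum_reindex _ hK hK); apply: eq_zsum => k.
rewrite (_ : 2 * (2 * (-1 - k) + 1) + 1 = 4 * - k + -1) ?slice_of_plane; last by lia.
by rewrite sgN -sliceN1; congr (_ * slice _ _ _); lia.
Qed.

End Slicing.

(** * The even part of lambda *)

(** g(q) = h(q^2). *)
Definition inflates g h := forall n, coef g (2 * n) = coef h n /\ coef g (2 * n).+1 = 0.

Lemma coef_mul_inflated f g h n : inflates g h ->
  coef (g * f) (2 * n) = \sum_(i < n.+1) coef h i * coef f (2 * (n - i)).
Proof.
move=> gh; rewrite coef_fpsM big_ord_recr /= (sum_even_odd (fun i => coef g i * coef f (2 * n - i))).
rewrite [RHS]big_ord_recr /= !subnn muln0 (gh n).1; congr (_ + _).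
by apply: eq_bigr => i _; rewrite (gh i).1 (gh i).2 mul0r addr0 mulnBr.
Qed.

Lemma inflatesM g h g' h' : inflates g h -> inflates g' h' -> inflates (g * g') (h * h').
Proof.
move=> gh gh' n; split.
  rewrite (coef_mul_inflated _ _ gh) coef_fpsM.
  by apply: eq_bigr => i _; rewrite (gh' _).1.
rewrite coef_fpsM -(big_mkord xpredT (fun i => coef g i * coef g' ((2 * n).+1 - i))).
rewrite (_ : (2 * n).+2 = 2 * n.+1)%N; last by lia.
rewrite big_mkord (sum_even_odd (fun i => coef g i * coef g' ((2 * n).+1 - i))) big1 // => -[i ni] _ /=.
rewrite (gh i).2 mul0r addr0 (_ : (2 * n).+1 - 2 * i = (2 * (n - i)).+1)%N; last by lia.
by rewrite (gh' _).2 mulr0.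
Qed.

Lemma inflates_factor k : inflates (1 - q ^+ (2 * k)) (1 - q ^+ k).
Proof.
move=> n; rewrite !coef_fpsD !coef_fpsN !coef_fps1 !qXn !coef_mono; split.
  by congr (_%:R - _); [congr nat_of_bool; lia | congr (if _ then _ else _); apply/eqP/eqP; lia].
by rewrite ifF ?subr0 //; lia.
Qed.

Lemma inflates_ell k : (0 < k)%N -> inflates (ell (2 * k)) (ell k).
Proof.
move=> k0.
have ip n : inflates (qpoch (q ^+ (2 * k)) (q ^+ (2 * k)) n) (qpoch (q ^+ k) (q ^+ k) n).
  elim: n => [|n IH].
    rewrite !qpoch0 => n; rewrite !coef_fps1; split=> //.
    by congr (_%:R); congr nat_of_bool; lia.
  rewrite !qpochS -!exprM -!exprD; apply: inflatesM => //.
  by rewrite (_ : 2 * k + 2 * k * n = 2 * (k + k * n))%N; [exact: inflates_factor | lia].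
have k20 : (0 < 2 * k)%N by lia.
move=> n; rewrite -!ellE.
have [e1 e2 e3] : [/\ 2 * n < (2 * n).+2, (2 * n).+1 < (2 * n).+2 & n < (2 * n).+2]%N.
  by split; lia.
have c2 := @cv_pinf (q ^+ (2 * k)) _ (coef0q k20) (2 * n).+2.
have c1 := @cv_pinf (q ^+ k) _ (coef0q k0) (2 * n).+2.
rewrite -(c2 _ e1) -(c2 _ e2) -(c1 _ e3); exact: ip.
Qed.

(** The even part, with q^2 replaced by q. *)
Definition evens f : fps int := Fps (fun n => coef f (2 * n)).

Lemma coef_evens f n : coef (evens f) n = coef f (2 * n). Proof. by []. Qed.

(** A factor that is a series in q^2 can be taken out of the even part. *)
Lemma evensM f g h : inflates g h -> evens (f * g) = evens f * h.
Proof.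
move=> gh; apply/fpsP => n; rewrite coef_evens mulrC (coef_mul_inflated _ _ gh).
rewrite [in RHS]mulrC coef_fpsM; reflexivity.
Qed.

(** [lambda_hecke] with all products written in terms of ell_1, ell_2 and ell_4. *)
Lemma lambda_psi : mock_lambda * (ell 2 * ell 4) = psi_neg 1 * hecke_lambda.
Proof.
have H := lambda_hecke.
have E1 := @pinf_neg 1 isT; have E2 := @pinf_odd 1 isT; have E3 := @psi_neg_product 1 isT.
rewrite !expr1 !muln1 in E1 E2 E3; rewrite E1 in H.
apply: (mulIr (ell_unit (isT : (0 < 1)%N))).
move: mock_lambda hecke_lambda H => la D H.
transitivity (la * ell 2 * (ell 1 * ell 4)); first by ring.
by rewrite H -E3 -E2; ring.
Qed.

(** The slicing identity, read as an identity between series. *)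
Lemma evens_psi_hecke : evens (psi_neg 1 * hecke_lambda) = phi_neg 12 * hecke_square 2 + 2 * (q * (psi_neg 6 * hecke_pronic 2)).
Proof.
have s1 := @dom_psi 1 isT; have s6 := @dom_psi 6 isT; have p12 := @dom_phi 12 isT.
apply/fpsP => N; rewrite coef_evens coef_fpsD coef_2qM /psi_neg /phi_neg coef_thetaM //.
rewrite (eq_zsum (G := fun t => sg t * hecke_lambda_sum (2 * N%:Z - (2 * t * t + t)))); last first.
  by move=> t; rewrite coefz_hecke_lambda; congr (_ * hecke_lambda_sum _); lia.
rewrite slicing coef_thetaM //; congr (_ + _).
  by apply: eq_zsum => k; rewrite coefz_hecke_square.
transitivity (2 * zsum (fun t => sg t * coefz (hecke_pronic 2) (N%:Z - 1 - 6 * (2 * t * t + t)))).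
  by rewrite -zsumM; apply: eq_zsum => k; rewrite coefz_hecke_pronic //; ring.
congr (_ * _); case: N => [|N].
  rewrite zsum0 // => t; have := s6 t; case E : (0%N%:Z - 1 - _) => [n|n]; last by rewrite mulr0.
  lia.
have e : N.+1%:Z - 1 = N%:Z by lia.
by rewrite e -[coefz _ N%:Z]/(coef _ N) coef_thetaM.
Qed.

(** The left-hand factors ell_2 ell_4 become ell_1 ell_2 in the even part. The two
    Hecke-type sums are rewritten by their products as psi(q^2) phi(-q^4) and
    psi(q^2) psi(-q^2), which prepares the use of [phi_hex] and [phi_psi]. *)
Lemma evens_lambda : evens mock_lambda = phi_neg 3 * pinf (- q) q ^+ 3.
Proof.
have u k : (0 < k)%N -> ell k \is a GRing.unit := @ell_unit k.
have E0 : evens mock_lambda * (ell 1 * ell 2) = phi_neg 12 * hecke_square 2 + 2 * (q * (psi_neg 6 * hecke_pronic 2)).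
  rewrite -evens_psi_hecke -lambda_psi; apply/esym/evensM/inflatesM.
    exact: (@inflates_ell 1).
  exact: (@inflates_ell 2).
move: (evens mock_lambda) E0 => el E0.
have P2 := @psi_pos_product 2 isT; have P1 := @psi_pos_product 1 isT.
have F4 := @phi_neg_product 4 isT; have S2 := @psi_neg_product 2 isT.
have V0E : hecke_square 2 = psi_pos 2 * phi_neg 4.
  apply: (mulIr (u 2 isT)); apply: (mulIr (u 8 isT)).
  have E : hecke_square 2 * (ell 2 * ell 8) = ell 4 ^+ 4 := @hecke_square_product 2 isT.
  have F : psi_pos 2 * ell 2 = ell 4 ^+ 2 := P2.
  have G : phi_neg 4 * ell 8 = ell 4 ^+ 2 := F4.
  rewrite -mulrA E (exprM _ 2 2) expr2 -{1}F -G; ring.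
have V1E : hecke_pronic 2 = psi_pos 2 * psi_neg 2.
  apply: (mulIr (u 2 isT)); apply: (mulIr (u 4 isT)).
  have E : hecke_pronic 2 = ell 4 * ell 8 := @hecke_pronic_product 2 isT.
  have F : psi_pos 2 * ell 2 = ell 4 ^+ 2 := P2.
  have G : psi_neg 2 * ell 4 = ell 2 * ell 8 := S2.
  transitivity ((psi_pos 2 * ell 2) * (psi_neg 2 * ell 4)); last by ring.
  rewrite F G E; ring.
have E1 : el * (ell 1 * ell 2) = psi_pos 1 * psi_pos 1 * phi_neg 3.
  rewrite E0 V0E V1E -phi_psi.
  transitivity (psi_pos 2 * (phi_neg 4 * phi_neg 12 + 2 * (q * (psi_neg 2 * psi_neg 6)))); first by ring.
  rewrite phi_hex; ring.
apply: (mulIr (u 2 isT)); apply: (mulIr (u 1%N isT)); apply: (mulIr (u 1%N isT)); apply: (mulIr (u 1%N isT)).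
have B := @pinf_neg 1 isT; rewrite !expr1 !muln1 in B; rewrite muln1 in P1.
transitivity (el * (ell 1 * ell 2) * ell 1 * ell 1); first by ring.
rewrite E1; transitivity ((psi_pos 1 * ell 1) * (psi_pos 1 * ell 1) * phi_neg 3); first by ring.
rewrite P1.
transitivity (phi_neg 3 * ell 2 * (ell 1 * pinf (- q) q) ^+ 3); last by ring.
rewrite B; ring.
Qed.

(** * Partitions into distinct parts of three colours *)

(** Expanding the product of the 1 + q^(i+1) over all parts i+1 <= n in three
    colours gives one monomial for each set of coloured parts; parts beyond n do not
    reach the coefficient of q^n. *)
Lemma p3d_gf n : (p3d_nat n)%:Z = coef (pinf (- q) q ^+ 3) n.
Proof.
have c n' : eqm n'.+1 (qpoch (- q) q n') (pinf (- q) q).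
  apply: (eqm_trans (g := qpoch (- q) q n'.+1)); last exact: (@cv_pinf (- q) q coefq n'.+1).
  rewrite qpochS mulNr opprK mulrDr mulr1 -[X in eqm _ X _]addr0.
  apply: eqmD; first exact: eqm_refl.
  apply: eqm_sym; rewrite -exprS; apply: eqm0Mr; exact: eqm0X.
have c3 : eqm n.+1 (qpoch (- q) q n ^+ 3) (pinf (- q) q ^+ 3).
  by rewrite !exprS !expr0; do !apply: eqmM => //; apply: eqm_refl.
rewrite -(c3 n (ltnSn n)).
have -> : qpoch (- q) q n ^+ 3 = \prod_(x : 'I_n * 'I_3) (q ^+ x.1.+1 + 1).
  rewrite -(pair_bigA _ (fun (i : 'I_n) (c : 'I_3) => q ^+ i.+1 + 1)) /qpoch -prodrXl.
  apply: eq_bigr => i _; rewrite prodr_const card_ord mulNr opprK -exprS addrC; reflexivity.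
rewrite bigA_distr coef_bigsum /p3d_nat -sum1_card -[LHS]natz natr_sum big_mkcond.
apply: eq_bigr => A _; rewrite -big_mkcond /= prodrXr qXn coef_mono inE.
by case: eqP => [->|nA]; [rewrite eqxx | rewrite ifF //; apply/eqP => -[]].
Qed.

Lemma zsum_symmetric (F : int -> int) : bounded F -> (forall t, F (- t) = F t) ->
  zsum F = F 0 + 2 * \sum_(k \in [set k : nat | (1 <= k)%N]%classic) F k%:Z.
Proof.
move=> [B sF] Fs; rewrite (@zsum_box B) // /boxsum.
have -> : \sum_(j < B) F (Negz j) = \sum_(j < B) F (Posz j.+1).
  by apply: eq_bigr => j _; rewrite NegzE Fs.
rewrite big_ord_recl -addrA; congr (_ + _).
have -> : \sum_(k \in [set k : nat | (1 <= k)%N]%classic) F k%:Z = \sum_(j < B) F (Posz j.+1).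
  transitivity (\sum_(j \in [set: nat]%classic) F (Posz j.+1)).
    apply: (@reindex_fsbig _ _ _ _ _ succn); split; [by move=> m _ | by move=> x y _ _ [] |].
    by case=> [|m] //= _; exists m.
  rewrite (fsbig_ord _ _ (fun j => F (Posz j.+1))).
  apply/esym/fsbig_widen => // m [_ /= nB]; apply/eqP; apply: contraT => nz.
  by case: nB; have := sF _ nz; lia.
by rewrite (_ : 2 = 1 + 1) // mulrDl mul1r.
Qed.

Lemma coefz_p3d z : coefz (pinf (- q) q ^+ 3) z = p3d z.
Proof. by case: z => n; [exact: esym (p3d_gf n) | exact: erefl]. Qed.

Theorem theorem6p2 (n : nat) :
  P_lambda (2 * n)%N =
    p3d n%:Z
    + 2 * \sum_(k \in [set k : nat | (1 <= k)%N]%classic)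
            (-1) ^+ k * p3d (n%:Z - 3 * k%:Z ^+ 2).
Proof.
have p3 := @dom_phi 3 isT.
rewrite /P_lambda -coef_evens evens_lambda /phi_neg coef_thetaM //.
rewrite (@eq_zsum _ (fun t => sg t * p3d (n%:Z - 3 * (t * t)))); last first.
  by move=> t; rewrite coefz_p3d.
rewrite zsum_symmetric; last 2 first.
- exists n => t; have := p3 t; case E : (n%:Z - 3 * (t * t)) => [m|m]; last by rewrite mulr0.
  by move: E; lia.
- by move=> t; rewrite sgN mulrNN.
by rewrite mul1r mul0r mulr0 subr0.
Qed.
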